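(* Consider the Euler equations with gravitation ($\omega=\phi$) or the Ripa model ($\omega=b$), written as $\boldsymbol U(\boldsymbol V)_t+\nabla\cdot\boldsymbol F(\boldsymbol U(\boldsymbol V))=\boldsymbol r(\boldsymbol U(\boldsymbol V),\omega)$ in terms of the equilibrium variables $\boldsymbol V$. Take the discontinuous Galerkin space discretization with spatial operator $$\mathrm{RHS}(\boldsymbol V,\omega,\boldsymbol\varphi)=\int_{\mathcal T}\boldsymbol F(\boldsymbol U(\boldsymbol V)):\nabla\boldsymbol\varphi\,d\boldsymbol x-\int_{\partial\mathcal T}\widehat{\boldsymbol F}^{*}\cdot\boldsymbol\varphi^{int_{\mathcal T}}\,ds+\int_{\mathcal T}\boldsymbol r(\boldsymbol U(\boldsymbol V),\omega)\cdot\boldsymbol\varphi\,d\boldsymbol x,$$ $$\widehat{\boldsymbol F}^{*}=\widehat{\boldsymbol F}(\boldsymbol U^{*,int_{\mathcal T}},\boldsymbol U^{*,ext_{\mathcal T}},\boldsymbol n)-\boldsymbol F(\boldsymbol U^{*,int_{\mathcal T}})\cdot\boldsymbol n+\boldsymbol F(\boldsymbol U^{int_{\mathcal T}})\cdot\boldsymbol n,$$ together with the third-order strong stability preserving Runge–Kutta time discretization with time step $\Delta t$: for all cells $\mathcal T\in\mathcal K$ and all $\boldsymbol\varphi\in\boldsymbol{\mathcal V}_h^k$, $$\int_{\mathcal T}\boldsymbol U(\boldsymbol V^{(1)})\cdot\boldsymbol\varphi\,d\boldsymbol x=\int_{\mathcal T}\boldsymbol U(\boldsymbol V^{n})\cdot\boldsymbol\varphi\,d\boldsymbol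 x+\Delta t\,\mathrm{RHS}(\boldsymbol V^n,\omega,\boldsymbol\varphi),$$ $$\int_{\mathcal T}\boldsymbol U(\boldsymbol V^{(2)})\cdot\boldsymbol\varphi\,d\boldsymbol x=\tfrac34\int_{\mathcal T}\boldsymbol U(\boldsymbol V^{n})\cdot\boldsymbol\varphi\,d\boldsymbol x+\tfrac14\left(\int_{\mathcal T}\boldsymbol U(\boldsymbol V^{(1)})\cdot\boldsymbol\varphi\,d\boldsymbol x+\Delta t\,\mathrm{RHS}(\boldsymbol V^{(1)},\omega,\boldsymbol\varphi)\right),$$ $$\int_{\mathcal T}\boldsymbol U(\boldsymbol V^{n+1})\cdot\boldsymbol\varphi\,d\boldsymbol x=\tfrac13\int_{\mathcal T}\boldsymbol U(\boldsymbol V^{n})\cdot\boldsymbol\varphi\,d\boldsymbol x+\tfrac23\left(\int_{\mathcal T}\boldsymbol U(\boldsymbol V^{(2)})\cdot\boldsymbol\varphi\,d\boldsymbol x+\Delta t\,\mathrm{RHS}(\boldsymbol V^{(2)},\omega,\boldsymbol\varphi)\right).$$ This fully-discrete DG method is exact for one-dimensional moving equilibria and two-dimensional hydrostatic equilibrium states; that is, if the initial values are in such an exact equilibrium state, the numerical solution remains equal to that state at all time levels.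
   Context: **Mesh and spaces.** $\mathcal K$ is a partition of the computational domain $\Omega\subset\mathbb R^d$ into cells $\mathcal T$ (intervals if $d=1$, rectangles $[x_{i-1/2},x_{i+1/2}]\times[y_{j-1/2},y_{j+1/2}]$ if $d=2$). $\mathcal W_h^k=\{w: w|_{\mathcal T}\in P^k(\mathcal T)\ \forall\mathcal T\in\mathcal K\}$, where $P^k(\mathcal T)$ is the space of polynomials of degree at most $k$ on $\mathcal T$; $\boldsymbol{\mathcal V}_h^k$ is the space of vectors with $d+2$ components in $\mathcal W_h^k$. The unknowns $\boldsymbol V^n$, $\boldsymbol V^{(1)}$, $\boldsymbol V^{(2)}$ lie in $\boldsymbol{\mathcal V}_h^k$; at each Runge–Kutta stage the nonlinear system for the new $\boldsymbol V$, local to each cell, is solved by Newton iteration. $\boldsymbol n$ is the outward unit normal on $\partial\mathcal T$. For $\boldsymbol x\in\partial\mathcal T$, $u^{int_{\mathcal T}}(\boldsymbol x)=\lim_{\epsilon\to0^+}u(\boldsymbol x-\epsilon\boldsymbol n)$ and $u^{ext_{\mathcal T}}(\boldsymbol x)=\lim_{\epsilon\to0^+}u(\boldsymbol x+\epsilon\boldsymbol n)$. ''$\cdot$'' is the Euclidean dot product and ''$:$'' the Frobenius inner product. **Euler with gravitation** (ideal gas, ratio of specific heats $\gamma$). $\rho_t+\nabla\cdot(\rho\boldsymbol u)=0$, $(\rho\boldsymbol u)_t+\nabla\cdot(\rho\boldsymbol u\otimes\boldsymbol u+p\mathbf I_d)=-\rho\nabla\phi$, $E_t+\nabla\cdot((E+p)\boldsymbol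 u)=-\rho\boldsymbol u\cdot\nabla\phi$, with density $\rho$, velocity $\boldsymbol u$, pressure $p=(\gamma-1)(E-\tfrac12\rho\|\boldsymbol u\|^2)$, total energy $E$, identity matrix $\mathbf I_d$, and time-independent gravitational potential $\phi=\phi(\boldsymbol x)$. Conservative variables $\boldsymbol U=(\rho,\rho\boldsymbol u,E)$; equilibrium variables $\boldsymbol V=(K,\rho\boldsymbol u,\varepsilon)$ with $$K=\frac p{\rho^\gamma},\qquad \varepsilon=\frac{\|\rho\boldsymbol u\|^2}{2\rho^2}+\frac{\gamma}{\gamma-1}\frac p\rho+\phi.$$ Inverse map $\boldsymbol U(\boldsymbol V,\phi)$: $\rho$ is the correct root of $\frac{\|\rho\boldsymbol u\|^2}{2\rho^2}+\frac{\gamma}{\gamma-1}K\rho^{\gamma-1}+\phi-\varepsilon=0$ with $\rho\boldsymbol u$ given, and $E=\frac{\|\rho\boldsymbol u\|^2}{2\rho}+\frac1{\gamma-1}K\rho^\gamma$. For zero momentum, $\rho=\left(\frac{\gamma-1}{K\gamma}(\varepsilon-\phi)\right)^{1/(\gamma-1)}$. For nonzero momentum, with $\rho_\star=\left(\|\rho\boldsymbol u\|^2/(\gamma K)\right)^{1/(\gamma+1)}$, one selects $\rho>\rho_\star$ for subsonic flow (Mach number $\|\boldsymbol u\|/\sqrt{\gamma K\rho^{\gamma-1}}<1$), $\rho<\rho_\star$ for supersonic flow (Mach number $>1$), and $\rho=\rho_\star$ at Mach number $1$. The map between $\boldsymbol U$ and $\boldsymbol V$ is one-to-one under the determined Mach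 number regime. **Ripa model.** In 2D: $h_t+(hu)_x+(hv)_y=0$, $(hu)_t+(hu^2+\frac12gh^2\theta)_x+(huv)_y=-gh\theta b_x$, $(hv)_t+(huv)_x+(hv^2+\frac12gh^2\theta)_y=-gh\theta b_y$, $(h\theta)_t+(hu\theta)_x+(hv\theta)_y=0$; in 1D drop $v$ and the $y$-derivatives. Here $h$ is water height, $(u,v)$ velocity, $\theta$ the potential temperature field, $g$ the gravitational constant, $b$ the bottom topography. Conservative variables $\boldsymbol U=(h,hu,hv,h\theta)$ (1D: $(h,hu,h\theta)$); equilibrium variables $\boldsymbol V=(E,hu,hv,\theta)$ (1D: $(E,hu,\theta)$) with $E=\frac{(hu)^2+(hv)^2}{2h^2}+g\theta(h+b)$ ($hv=0$ in 1D). Inverse map $\boldsymbol U(\boldsymbol V,b)$: $h$ is the correct (physically relevant) root of $g\theta h^3-(E-gb\theta)h^2+\frac12((hu)^2+(hv)^2)=0$ with the discharges given; for zero discharge $h=\frac E{g\theta}-b$; for nonzero discharge the smaller positive root is supercritical, the larger is subcritical, and they coincide at the sonic point. The regime is determined by the Froude number (in 1D $|u|/\sqrt{gh\theta}$), and the map is one-to-one under the determined Froude number regime. $\boldsymbol U(\boldsymbol V)$ abbreviates $\boldsymbol U(\boldsymbol V,\omega)$; $\boldsymbol F$ and $\boldsymbol r$ are the flux and source of the system. **Interface values and flux.** With $\omega^*=\max(\omega^{int_{\mathcal T}},\omega^{ext_{\mathcal T}})$: $\boldsymbol U^{int_{\mathcal T}}=\boldsymbol U(\boldsymbol V^{int_{\mathcal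 T}},\omega^{int_{\mathcal T}})$, $\boldsymbol U^{ext_{\mathcal T}}=\boldsymbol U(\boldsymbol V^{ext_{\mathcal T}},\omega^{ext_{\mathcal T}})$, $\boldsymbol U^{*,int_{\mathcal T}}=\boldsymbol U(\boldsymbol V^{int_{\mathcal T}},\omega^* )$, $\boldsymbol U^{*,ext_{\mathcal T}}=\boldsymbol U(\boldsymbol V^{ext_{\mathcal T}},\omega^* )$. The numerical flux $\widehat{\boldsymbol F}$ is consistent, $\widehat{\boldsymbol F}(\boldsymbol U,\boldsymbol U,\boldsymbol n)=\boldsymbol F(\boldsymbol U)\cdot\boldsymbol n$. It is chosen as the Lax–Friedrichs flux $\widehat{\boldsymbol F}(\boldsymbol U^{int},\boldsymbol U^{ext},\boldsymbol n)=\frac12\left(\boldsymbol F(\boldsymbol U^{int})\cdot\boldsymbol n+\boldsymbol F(\boldsymbol U^{ext})\cdot\boldsymbol n-\alpha(\boldsymbol U^{ext}-\boldsymbol U^{int})\right)$, $\alpha=\max_{\boldsymbol U}\left|\frac{\partial\boldsymbol F}{\partial\boldsymbol U}\cdot\boldsymbol n\right|$ (global maximum). If isolated flow discontinuities exist, the Roe flux, or the HLLC flux with carefully chosen wave speeds, is used instead so as to preserve the well-balanced property. **Equilibria.** One-dimensional moving equilibria: for Euler, specific entropy (equivalently $K$), $\rho u$ and $\varepsilon$ constant; for Ripa, $hu$, $E$ and $\theta$ constant. Two-dimensional hydrostatic equilibria: for Euler, the isentropic state $\boldsymbol u=0$ with specific entropy (equivalently $K$) and $\frac{\gamma}{\gamma-1}\frac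 p\rho+\phi$ constant; for Ripa, the still water state $u=v=0$ with $\theta$ and $h+b$ constant. In these states $\boldsymbol V$ is constant. Equilibria in which stationary shocks separate smooth equilibrium regions are also covered when all the shocks are located at cell boundaries, using the Roe or HLLC flux, which resolves the stationary shock exactly.
   Formalization: Added: Newton's iteration in each stage starts from the latest stage (the nonlinear system may have other solutions); exterior values on the domain boundary agree with the equilibrium; ω is C¹ on each closed cell and continuous at shocks; ρ, p (or h, θ) are positive. *)

(* Defs.v *)
From HB Require Import structures.
From mathcomp Require Import all_boot all_order all_algebra.
From mathcomp Require Import all_classical all_reals all_analysis.

Set Implicit Arguments.
Unset Strict Implicit.
Unset Printing Implicit Defensive.

Import Order.TTheory GRing.Theory Num.Theory.
Import numFieldNormedType.Exports.

Local Open Scope classical_set_scope.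
Local Open Scope ring_scope.

Section Vectors.
Context {R : realType}.

Definition dotp {n} (u v : 'rV[R]_n) : R := \sum_i u 0 i * v 0 i.
Definition sqnorm {n} (u : 'rV[R]_n) : R := dotp u u.
Definition frobenius {m n} (A B : 'M[R]_(m, n)) : R :=
  \sum_i \sum_j A i j * B i j.

Context {d : nat}.

(* Conservative variables (density or height, momentum or discharge, energy or
   h * theta) and equilibrium variables (K or E, momentum, epsilon or theta)
   both have d + 2 components, stored as scalar | d-vector | scalar. *)
Definition mkstate (a : R) (m : 'rV[R]_d) (b : R) : 'rV[R]_(1 + d + 1) :=
  row_mx (row_mx a%:M m) b%:M.
Definition first_c (U : 'rV[R]_(1 + d + 1)) : R := lsubmx (lsubmx U) 0 0.
Definition mom (U : 'rV[R]_(1 + d + 1)) : 'rV[R]_d := rsubmx (lsubmx U).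
Definition last_c (U : 'rV[R]_(1 + d + 1)) : R := rsubmx U 0 0.
Definition vel (U : 'rV[R]_(1 + d + 1)) : 'rV[R]_d :=
  (first_c U)^-1 *: mom U.

(* Fluxes are stored transposed: row i is the flux in direction i, so that
   F(U) . n is the row vector n *m F. *)
Definition mkflux (a : 'rV[R]_d) (m : 'M[R]_d) (b : 'rV[R]_d) :
    'M[R]_(d, 1 + d + 1) := row_mx (row_mx a^T m) b^T.

End Vectors.

Notation state R d := 'rV[R]_(1 + d + 1).

(** Balance laws *)

Inductive model (R : Type) : Type :=
| Euler of R   (* ratio of specific heats *)
| Ripa of R.   (* gravitational constant *)

Definition valid_model (R : realType) (M : model R) : Prop :=
  match M with Euler gamma => 1 < gamma | Ripa g => 0 < g end.

Inductive regime : Set := Sub | Crit | Super.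

Definition classify (R : realType) (x : R) : regime :=
  if x < 1 then Sub else if x == 1 then Crit else Super.

Section EulerGravity.
Context {R : realType} {d : nat}.
Variable gamma : R.
Implicit Types U V : state R d.

Definition pressure U : R :=
  (gamma - 1) * (last_c U - 2^-1 * first_c U * sqnorm (vel U)).

Definition euler_flux U : 'M[R]_(d, 1 + d + 1) :=
  mkflux (mom U)
         (first_c U *: ((vel U)^T *m vel U) + (pressure U)%:M)
         ((last_c U + pressure U) *: vel U).

Definition euler_source U (dphi : 'rV[R]_d) : state R d :=
  mkstate 0 (- first_c U *: dphi) (- (first_c U * dotp (vel U) dphi)).

Definition entropyK U : R := pressure U / first_c U `^ gamma.

Definition euler_eqvars U (phi : R) : state R d :=
  mkstate (entropyK U) (mom U)
    (sqnorm (mom U) / (2 * first_c U ^+ 2)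
     + gamma / (gamma - 1) * (pressure U / first_c U) + phi).

Definition euler_sound U : R :=
  Num.sqrt (gamma * entropyK U * first_c U `^ (gamma - 1)).

Definition rho_star V : R :=
  (sqnorm (mom V) / (gamma * first_c V)) `^ (gamma + 1)^-1.

Definition density_eq V (phi rho : R) : Prop :=
  sqnorm (mom V) / (2 * rho ^+ 2)
  + gamma / (gamma - 1) * first_c V * rho `^ (gamma - 1) + phi - last_c V = 0.

Definition density (rg : regime) V (phi : R) : R :=
  if mom V == 0 then
    ((gamma - 1) / (first_c V * gamma) * (last_c V - phi)) `^ (gamma - 1)^-1
  else xget 0 [set rho : R | [/\ 0 < rho, density_eq V phi rho &
    match rg return Prop with
    | Sub => rho_star V < rho
    | Crit => rho = rho_star V
    | Super => rho < rho_star V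
    end]].

Definition euler_inverse (rg : regime) V (phi : R) : state R d :=
  let rho := density rg V phi in
  mkstate rho (mom V)
    (sqnorm (mom V) / (2 * rho) + (gamma - 1)^-1 * first_c V * rho `^ gamma).

End EulerGravity.

Section RipaModel.
Context {R : realType} {d : nat}.
Variable g : R.
Implicit Types U V : state R d.

Definition theta U : R := last_c U / first_c U.

Definition ripa_flux U : 'M[R]_(d, 1 + d + 1) :=
  mkflux (mom U)
         (first_c U *: ((vel U)^T *m vel U)
          + (2^-1 * g * first_c U ^+ 2 * theta U)%:M)
         (last_c U *: vel U).

Definition ripa_source U (db : 'rV[R]_d) : state R d :=
  mkstate 0 (- (g * first_c U * theta U) *: db) 0.

Definition ripa_eqvars U (b : R) : state R d :=
  mkstate (sqnorm (mom U) / (2 * first_c U ^+ 2)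
           + g * theta U * (first_c U + b))
          (mom U) (theta U).

Definition ripa_sound U : R := Num.sqrt (g * first_c U * theta U).

Definition height_root V (b h : R) : Prop :=
  0 < h /\
  g * last_c V * h ^+ 3 - (first_c V - g * b * last_c V) * h ^+ 2
  + 2^-1 * sqnorm (mom V) = 0.

Definition height (rg : regime) V (b : R) : R :=
  if mom V == 0 then first_c V / (g * last_c V) - b
  else xget 0 [set h : R | height_root V b h /\
    forall h', height_root V b h' ->
      match rg return Prop with
      | Sub => h' <= h
      | Crit => h' = h
      | Super => h <= h'
      end].

Definition ripa_inverse (rg : regime) V (b : R) : state R d :=
  let h := height rg V b in mkstate h (mom V) (h * last_c V).

End RipaModel.

Section Laws.
Context {R : realType} {d : nat}.
Variable M : model R.
Implicit Types U V : state R d.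

Definition flux U : 'M[R]_(d, 1 + d + 1) :=
  match M with Euler gamma => euler_flux gamma U | Ripa g => ripa_flux g U end.

(* [dw] is the gradient of phi, respectively of b. *)
Definition source U (dw : 'rV[R]_d) : state R d :=
  match M with Euler _ => euler_source U dw | Ripa g => ripa_source g U dw end.

Definition eqvars U (w : R) : state R d :=
  match M with
  | Euler gamma => euler_eqvars gamma U w
  | Ripa g => ripa_eqvars g U w
  end.

Definition inverse (rg : regime) V (w : R) : state R d :=
  match M with
  | Euler gamma => euler_inverse gamma rg V w
  | Ripa g => ripa_inverse g rg V w
  end.

Definition physical U : Prop :=
  match M with
  | Euler gamma => 0 < first_c U /\ 0 < pressure gamma U
  | Ripa _ => 0 < first_c U /\ 0 < theta U
  end.

Definition sound U : R :=
  match M with Euler gamma => euler_sound gamma U | Ripa g => ripa_sound g U end.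

(* Mach number for Euler, Froude number for Ripa. *)
Definition mach U : R := Num.sqrt (sqnorm (vel U)) / sound U.

(* Together with vanishing velocity, constancy of these quantities is the
   isentropic hydrostatic state (Euler), resp. the still water state (Ripa). *)
Definition hydrostatic_vars U (w : R) : state R d :=
  match M with
  | Euler gamma =>
      mkstate (entropyK gamma U) (vel U)
        (gamma / (gamma - 1) * (pressure gamma U / first_c U) + w)
  | Ripa _ => mkstate (first_c U + w) (vel U) (theta U)
  end.

(* Rankine-Hugoniot condition at zero shock speed, with Lax' condition that the
   flow crosses the shock from the supersonic to the subsonic side; n points
   from UL to UR. *)
Definition stationary_shock UL UR (n : 'rV[R]_d) : Prop :=
  let unL := dotp (vel UL) n in let unR := dotp (vel UR) n in
  n *m flux UL = n *m flux UR /\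
  ([/\ sound UL < unL, 0 < unR & unR < sound UR] \/
   [/\ unR < - sound UR, - sound UL < unL & unL < 0]).

(** Properties of a numerical flux Fhat(U^int, U^ext, n) *)

Lemma half_twice (u : state R d) : 2^-1 *: (u + u) = u.
Proof. by rewrite scalerDr -scalerDl -[2^-1]mul1r -splitr scale1r. Qed.

Definition consistent (Fhat : state R d -> state R d -> 'rV[R]_d -> state R d) :=
  forall U n, physical U -> sqnorm n = 1 -> Fhat U U n = n *m flux U.

Definition resolves_shocks
    (Fhat : state R d -> state R d -> 'rV[R]_d -> state R d) :=
  forall UL UR n, physical UL -> physical UR -> sqnorm n = 1 ->
    stationary_shock UL UR n -> Fhat UL UR n = n *m flux UL.

Definition lax_friedrichs (alpha : R) UL UR (n : 'rV[R]_d) : state R d :=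
  2^-1 *: (n *m flux UL + n *m flux UR - alpha *: (UR - UL)).

Lemma lax_friedrichs_consistent (alpha : R) : consistent (lax_friedrichs alpha).
Proof.
by move=> U n _ _; rewrite /lax_friedrichs subrr scaler0 subr0 half_twice.
Qed.

(* The Roe matrix P diag(lambda) P^-1 acts on row vectors from the right. *)
Definition is_roe (Fhat : state R d -> state R d -> 'rV[R]_d -> state R d) :=
  forall UL UR n, physical UL -> physical UR -> sqnorm n = 1 ->
  exists P lambda, [/\ P \in unitmx,
    (UR - UL) *m (P *m diag_mx lambda *m invmx P) = n *m flux UR - n *m flux UL &
    Fhat UL UR n = 2^-1 *: (n *m flux UL + n *m flux UR
      - (UR - UL) *m (P *m diag_mx (map_mx Num.norm lambda) *m invmx P))].

Lemma roe_consistent Fhat : is_roe Fhat -> consistent Fhat.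
Proof.
move=> roe U n pU n1; have [P [l [_ _ ->]]] := roe U U n pU pU n1.
by rewrite subrr mul0mx subr0 half_twice.
Qed.

Lemma roe_resolves_shocks Fhat : is_roe Fhat -> resolves_shocks Fhat.
Proof.
move=> roe UL UR n pL pR n1 [RH _]; have [P [l [uP]]] := roe UL UR n pL pR n1.
rewrite RH subrr => /(congr1 (mulmx^~ P)); rewrite mul0mx !mulmxA mulmxKV//.
move=> /rowP Dl ->.
suff -> : (UR - UL) *m P *m diag_mx (map_mx Num.norm l) = 0.
  by rewrite mul0mx subr0 half_twice.
apply/rowP => j; move: (Dl j); rewrite !mul_mx_diag !mxE => /eqP.
by rewrite mulf_eq0 => /orP[|] /eqP ->; rewrite ?mul0r// normr0 mulr0.
Qed.

End Laws.

(** Integration over boxes; only dimensions at most 2 are used (the integral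
    over a point, for the faces in 1D, is the evaluation) *)

Definition box_integral (R : realType) (d : nat) :
    'rV[R]_d -> 'rV[R]_d -> ('rV[R]_d -> R) -> R :=
  let mu := @lebesgue_measure R in
  match d with
  | 0%N => fun _ _ f => f 0
  | 1%N => fun a b f => \int[mu]_(s in `[a 0 0, b 0 0]) f (const_mx s)
  | 2%N => fun a b f =>
      Rintegral (mu \x mu)%E
        (`[a 0 0, b 0 0]%classic `*` `[a 0 1, b 0 1]%classic)
        (fun z => f (\row_j if j == 0 then z.1 else z.2))
  | _ => fun _ _ _ => 0
  end.

Section Polynomials.
Context {R : realType} {d : nat}.
Variable k : nat.

(* Polynomials in d variables of total degree at most k. *)
Definition is_poly (f : 'rV[R]_d -> R) : Prop :=
  exists a : {ffun 'I_d -> 'I_k.+1} -> R, forall x,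
    f x = \sum_(e : {ffun 'I_d -> 'I_k.+1} | (\sum_i e i <= k)%N)
            a e * \prod_i x 0 i ^+ e i.

Definition vec_poly (f : 'rV[R]_d -> state R d) : Prop :=
  forall c, is_poly (fun x => f x 0 c).

End Polynomials.

Definition pderiv (R : realType) (d : nat) (f : 'rV[R]_d -> R) (i : 'I_d)
    (x : 'rV[R]_d) : R := 'D_(delta_mx 0 i) f x.

Definition C1_on (R : realType) (d : nat) (A : set 'rV[R]_d)
    (f : 'rV[R]_d -> R) : Prop :=
  (forall x, A x -> differentiable f x) /\
  (forall i, {within A, continuous (pderiv f i)}).

(* Cells are multi-indices: cell c occupies [node i (c i - 1), node i (c i)]
   along axis i. The cells of the mesh have 1 <= c i <= ncells i; the indices 0
   and ncells i + 1 are ghost cells, from which the exterior traces on the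
   boundary of the domain are taken. *)
Definition cell (d : nat) := {ffun 'I_d -> nat}.

(* A broken function has one branch per cell; its interior trace at a point of
   the boundary of T is the value of the branch on T, which coincides with the
   one-sided limit for branches continuous on the closed cell. *)
Definition field (R : realType) (d : nat) := cell d -> 'rV[R]_d -> state R d.

Record scheme (R : realType) (d : nat) := Scheme {
  law : model R;
  ncells : 'I_d -> nat;
  node : 'I_d -> nat -> R;
  omega : cell d -> 'rV[R]_d -> R;
  (* the regime determining which root is taken in the inverse map *)
  flow : cell d -> 'rV[R]_d -> regime;
  (* boundary treatment: exterior values in ghost cells, from the current V *)
  ghost : field R d -> field R d;
  (* the dependence on the current V is for the Lax-Friedrichs coefficient,
     a global maximum over the numerical solution *)
  numflux : field R d -> state R d -> state R d -> 'rV[R]_d -> state R d;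
  degree : nat;
  dt : R
}.

Section Mesh.
Context {R : realType} {d : nat}.
Variable S : scheme R d.
Implicit Types (T : cell d) (i : 'I_d) (s : bool) (x : 'rV[R]_d).

Definition in_mesh T : Prop := forall i, (0 < T i <= ncells S i)%N.

Definition valid_mesh : Prop :=
  forall i j, (j < ncells S i)%N -> node S i j < node S i j.+1.

Definition lo T : 'rV[R]_d := \row_i node S i (T i).-1.
Definition hi T : 'rV[R]_d := \row_i node S i (T i).
Definition closed_cell T : set 'rV[R]_d :=
  [set x | forall i, lo T 0 i <= x 0 i <= hi T 0 i].

(* The face (i, s) is orthogonal to axis i, on the upper side if s = true. *)
Definition face_coord T i s : R := if s then hi T 0 i else lo T 0 i.
Definition face T i s : set 'rV[R]_d :=
  [set x | closed_cell T x /\ x 0 i = face_coord T i s].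
Definition normal i s : 'rV[R]_d := (-1) ^+ (~~ s) *: delta_mx 0 i.
Definition neighbor T i s : cell d :=
  [ffun j => if j == i then (if s then (T j).+1 else (T j).-1) else T j].

Definition insert i (t : R) (y : 'rV[R]_d.-1) : 'rV[R]_d :=
  \row_j (if unlift i j is Some l then y 0 l else t).

Definition cell_integral T (f : 'rV[R]_d -> R) : R :=
  box_integral (lo T) (hi T) f.
Definition face_integral T i s (f : 'rV[R]_d -> R) : R :=
  box_integral (col' i (lo T)) (col' i (hi T))
    (fun y => f (insert i (face_coord T i s) y)).

End Mesh.

Section Method.
Context {R : realType} {d : nat}.
Variable S : scheme R d.
Implicit Types (T : cell d) (i : 'I_d) (s : bool) (x : 'rV[R]_d).
Implicit Types (V : field R d) (w phi : 'rV[R]_d -> state R d).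

Let P := vec_poly (degree S) : ('rV[R]_d -> state R d) -> Prop.

Definition grad_omega T x : 'rV[R]_d := \row_i pderiv (omega S T) i x.

Definition Vext V T i s x : state R d :=
  let T' := neighbor T i s in
  if `[< in_mesh S T' >] then V T' x else ghost S V T' x.

Definition omega_star T i s x : R :=
  Num.max (omega S T x) (omega S (neighbor T i s) x).

(* Regime of the state reconstructed from the V of cell A at omega^*, across a
   face shared with cell B: that of the cell in which omega^* is attained, and
   that of A itself if omega is continuous. *)
Definition flow_star (A B : cell d) x : regime :=
  if omega S B x <= omega S A x then flow S A x else flow S B x.

Definition Uint V T x : state R d :=
  inverse (law S) (flow S T x) (V T x) (omega S T x).
Definition Ustar_int V T i s x : state R d :=
  inverse (law S) (flow_star T (neighbor T i s) x)
    (V T x) (omega_star T i s x).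
Definition Ustar_ext V T i s x : state R d :=
  inverse (law S) (flow_star (neighbor T i s) T x)
    (Vext V T i s x) (omega_star T i s x).

Definition flux_star V T i s x : state R d :=
  numflux S V (Ustar_int V T i s x) (Ustar_ext V T i s x) (normal i s)
  - normal i s *m flux (law S) (Ustar_int V T i s x)
  + normal i s *m flux (law S) (Uint V T x).

Definition grad_test phi x : 'M[R]_(d, 1 + d + 1) :=
  \matrix_(i, c) pderiv (fun y => phi y 0 c) i x.

Definition dg_rhs V T phi : R :=
  cell_integral S T
    (fun x => frobenius (flux (law S) (Uint V T x)) (grad_test phi x))
  - \sum_i \sum_(s : bool)
      face_integral S T i s (fun x => dotp (flux_star V T i s x) (phi x))
  + cell_integral S T
      (fun x => dotp (source (law S) (Uint V T x) (grad_omega T x)) (phi x)).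

(* int_T U(w) . phi, for w given on T only *)
Definition massU T w phi : R :=
  cell_integral S T (fun x =>
    dotp (inverse (law S) (flow S T x) (w x) (omega S T x)) (phi x)).

(** One Runge-Kutta stage asks, on each cell, for the solution w of
    massU T w phi = G phi (for all phi), computed by Newton iteration *)

Definition solves T (G : ('rV[R]_d -> state R d) -> R) w : Prop :=
  forall phi, P phi -> massU T w phi = G phi.

(* The iteration stops at a zero of the residual; otherwise the increment
   solves the linearised system. *)
Definition newton_step T G w w' : Prop :=
  (solves T G w /\ w' = w) \/
  [/\ ~ solves T G w, P w' & forall phi, P phi ->
     is_derive (0 : R) (1 : R)
       (fun t : R => massU T (fun x => w x + t *: (w' x - w x)) phi)
       (G phi - massU T w phi)].

Definition newton_solution T G w0 w : Prop :=
  [/\ P w, solves T G w &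
   exists it : nat -> 'rV[R]_d -> state R d,
     [/\ it 0%N = w0, forall m, newton_step T G (it m) (it m.+1) &
         forall x c, it m x 0 c @[m --> \oo] --> w x 0 c]].

Definition stage1 V T phi : R :=
  massU T (V T) phi + dt S * dg_rhs V T phi.
Definition stage2 V V1 T phi : R :=
  3 / 4 * massU T (V T) phi
  + 1 / 4 * (massU T (V1 T) phi + dt S * dg_rhs V1 T phi).
Definition stage3 V V2 T phi : R :=
  1 / 3 * massU T (V T) phi
  + 2 / 3 * (massU T (V2 T) phi + dt S * dg_rhs V2 T phi).

(* V n is the solution at time level n, V1 n and V2 n the two inner stages;
   Newton's iteration starts from the latest available stage. *)
Definition numerical_solution (V V1 V2 : nat -> field R d) : Prop :=
  (forall T, in_mesh S T -> P (V 0%N T)) /\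
  forall n T, in_mesh S T ->
    [/\ newton_solution T (stage1 (V n) T) (V n T) (V1 n T),
        newton_solution T (stage2 (V n) (V1 n) T) (V1 n T) (V2 n T) &
        newton_solution T (stage3 (V n) (V2 n) T) (V2 n T) (V n.+1 T)].

End Method.

Section Equilibria.
Context {R : realType} {d : nat}.
Variable S : scheme R d.
(* the equilibrium state, in conservative variables *)
Variable Ueq : field R d.
Implicit Types (T : cell d) (i : 'I_d) (s : bool) (x : 'rV[R]_d).

Definition eqV T x : state R d := eqvars (law S) (Ueq T x) (omega S T x).

Definition equals_eq (V : field R d) : Prop :=
  forall T, in_mesh S T -> forall x, closed_cell S T x -> V T x = eqV T x.

(* U(V^int) and U(V^ext) use the regime of the equilibrium flow. *)
Definition physical_at T x : Prop :=
  physical (law S) (Ueq T x) /\ flow S T x = classify (mach (law S) (Ueq T x)).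

(* The state may jump across a smooth face only where omega does. *)
Definition smooth_face (J : state R d -> R -> state R d) T i s : Prop :=
  let T' := neighbor T i s in
  forall x, face S T i s x ->
    J (Ueq T x) (omega S T x) = J (Ueq T' x) (omega S T' x) /\
    (omega S T x = omega S T' x -> Ueq T x = Ueq T' x).

Definition shock_face T i s : Prop :=
  let T' := neighbor T i s in
  forall x, face S T i s x ->
    omega S T x = omega S T' x /\
    stationary_shock (law S) (Ueq T x) (Ueq T' x) (normal i s).

(* Piecewise equilibrium characterised by constancy of the quantities J, with
   stationary shocks allowed at cell boundaries. The faces are those of the
   mesh, including the ones between a cell and a ghost cell. *)
Definition equilibrium (J : state R d -> R -> state R d) : Prop :=
  forall T, in_mesh S T ->
    [/\ {within closed_cell S T, continuous (Ueq T)},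
        exists c, forall x, closed_cell S T x ->
          physical_at T x /\ J (Ueq T x) (omega S T x) = c &
        forall i s,
          (forall x, face S T i s x -> physical_at (neighbor T i s) x) /\
          (smooth_face J T i s \/ shock_face T i s)].

Definition moving_equilibrium : Prop := equilibrium (eqvars (law S)).

Definition hydrostatic_equilibrium : Prop :=
  equilibrium (hydrostatic_vars (law S)) /\
  (forall T, in_mesh S T -> forall x, closed_cell S T x -> vel (Ueq T x) = 0).

Definition shock_free : Prop :=
  forall T i s, in_mesh S T -> ~ shock_face T i s.

(* The boundary treatment reproduces the equilibrium in the ghost cells when
   the numerical solution is in equilibrium. *)
Definition compatible_boundary : Prop :=
  forall V, equals_eq V ->
  forall T i s x, in_mesh S T -> ~ in_mesh S (neighbor T i s) ->
    face S T i s x ->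
    ghost S V (neighbor T i s) x = eqV (neighbor T i s) x.

End Equilibria.

(* Main.v *)
Require Import Defs.
From HB Require Import structures.
From mathcomp Require Import all_boot all_order all_algebra.
From mathcomp Require Import all_classical all_reals all_analysis.
From mathcomp Require Import ring lra.

Set Implicit Arguments.
Unset Strict Implicit.
Unset Printing Implicit Defensive.

Import Order.TTheory GRing.Theory Num.Theory.
Import numFieldNormedType.Exports.

Local Open Scope classical_set_scope.
Local Open Scope ring_scope.

(** At an equilibrium the variables V are constant on each cell. If the spatial
residual vanishes for such a V, then each Runge-Kutta stage is already solved by
the starting value of its Newton iteration, which therefore never moves.

To see that the residual vanishes: at an interface either V is continuous, so
that both states reconstructed at omega^* coincide and consistency applies, or
there is a stationary shock, which the numerical flux resolves. In both cases
F^* is the interior flux, and integration by parts in the cell reduces the claim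
to div F(U) = r(U, omega).

For smooth flow this identity follows from constancy of V by the chain rule,
except at sonic points, where the density need not be differentiable. There it
still holds: with e(rho) the energy and G(rho) the momentum flux at fixed
momentum and entropy, G' = rho e' and e'(rho) changes sign only at the critical
density. Cauchy's mean value theorem then gives
G(rho(y)) - G(rho(x)) = c (e(rho(y)) - e(rho(x))) with c between rho(x) and
rho(y), and e(rho) = const - omega, so that continuity of rho suffices for
d(G(rho)) = - rho d(omega). The same monotonicity of e on both sides of the
critical density shows that the inverse map recovers U. *)

(** * The energy and momentum flux as functions of the density *)

Lemma is_derive_invr (R : realFieldType) (V : normedModType R) (f : V -> R)
    (x v : V) (df : R) :
  f x != 0 -> is_derive x v f df ->
  is_derive x v (fun y => (f y)^-1) (- df / f x ^+ 2).
Proof.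
move=> fx0 dfx; have fd := @ex_derive _ _ _ _ _ _ _ dfx.
apply: DeriveDef; first exact: derivableV.
by rewrite deriveV// derive_val /GRing.scale/= mulNr mulrC mulNr.
Qed.

Lemma powR_sub1 (R : realType) (r a : R) : 0 < r -> r `^ (a - 1) = r `^ a / r.
Proof.
move=> r0; have rN0 : (a == 1) ==> (r != 0) by rewrite (gt_eqF r0) implybT.
by rewrite (powRB rN0) powRr1 ?ltW.
Qed.

Lemma powR_add1 (R : realType) (r a : R) : 0 < r -> r `^ (a + 1) = r `^ a * r.
Proof.
by move=> r0; rewrite powRD ?powRr1 ?ltW//; rewrite (gt_eqF r0) implybT.
Qed.

Section EnergyProfile.
Context {R : realType}.
Variables gamma K s : R.
Hypotheses (gamma_gt1 : 1 < gamma) (K_gt0 : 0 < K) (s_ge0 : 0 <= s).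

Let gamma_gt0 : 0 < gamma. Proof. exact: lt_trans gamma_gt1. Qed.
Let gammaS_gt0 : 0 < gamma + 1. Proof. exact: addr_gt0. Qed.
Let gammaK_gt0 : 0 < gamma * K. Proof. exact: mulr_gt0. Qed.

(* In the notation of the paper [s] is the squared norm of rho u. The Ripa model
   is the case [gamma = 2], [K = g theta / 2], with [r] the water height. *)
Definition energy_profile (r : R) : R :=
  s / (2 * r ^+ 2) + gamma / (gamma - 1) * K * r `^ (gamma - 1).

(** The momentum flux rho u^2 + p along the flow, for a momentum of squared norm [s] and the
    isentropic pressure K r^gamma. *)
Definition momentum_profile (r : R) : R := s / r + K * r `^ gamma.

(** The sonic density, where the squared speed s / r^2 equals the squared sound speed gamma K
    r^(gamma - 1). It is 0 for fluid at rest, so that every positive density then counts as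
    subsonic. *)
Definition critical_density : R := (s / (gamma * K)) `^ (gamma + 1)^-1.

(** Brought over a common denominator: the sign is that of the numerator, which increases in [r] and
    vanishes at [critical_density]. *)
Definition energy_profile_deriv (r : R) : R :=
  (gamma * K * r `^ (gamma + 1) - s) / r ^+ 3.

Local Notation f := energy_profile.
Local Notation df := energy_profile_deriv.
Local Notation G := momentum_profile.
Local Notation rs := critical_density.

Lemma is_derive_energy_profile (r : R) : 0 < r -> is_derive r 1 f (df r).
Proof.
move=> r0; have rN0 : r != 0 by rewrite gt_eqF.
have dV : is_derive r 1 (fun x : R => (2 * x ^+ 2)^-1)
    (- (2 * (2 * r)) / (2 * r ^+ 2) ^+ 2).
  apply: is_derive_invr; first by rewrite mulf_neq0 ?expf_neq0.
  by apply: is_derive_eq; rewrite /GRing.scale/=; ring.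
have dp := is_derive1_powR (gamma - 1) r0.
apply: is_derive_eq; rewrite /GRing.scale/= /df powR_add1//.
rewrite !powR_sub1//.
by field; rewrite rN0 subr_eq0 gt_eqF.
Qed.

Lemma is_derive_momentum_profile (r : R) : 0 < r -> is_derive r 1 G (r * df r).
Proof.
move=> r0; have rN0 : r != 0 by rewrite gt_eqF.
have dV : is_derive r 1 (fun x : R => x^-1) (- 1 / r ^+ 2).
  exact: is_derive_invr.
have dp := is_derive1_powR gamma r0.
apply: is_derive_eq; rewrite /GRing.scale/= /df powR_add1//.
by rewrite !powR_sub1//; field.
Qed.

Lemma continuous_energy_profile (r : R) : 0 < r -> {for r, continuous f}.
Proof.
move=> r0; apply: differentiable_continuous; apply/derivable1_diffP.
exact: (@ex_derive _ _ _ _ _ _ _ (is_derive_energy_profile r0)).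
Qed.

Lemma continuous_momentum_profile (r : R) : 0 < r -> {for r, continuous G}.
Proof.
move=> r0; apply: differentiable_continuous; apply/derivable1_diffP.
exact: (@ex_derive _ _ _ _ _ _ _ (is_derive_momentum_profile r0)).
Qed.

Lemma critical_density_ge0 : 0 <= rs. Proof. exact: powR_ge0. Qed.

Lemma critical_densityX : gamma * K * rs `^ (gamma + 1) = s.
Proof.
have sgK_ge0 : 0 <= s / (gamma * K) by rewrite divr_ge0// ltW.
rewrite /rs -powRrM mulVf ?(gt_eqF gammaS_gt0)// powRr1//.
by rewrite mulrC divfK// gt_eqF.
Qed.

Lemma energy_profile_deriv_gt0 r : rs < r -> 0 < df r.
Proof.
move=> rsr; have r0 : 0 < r by apply: le_lt_trans rsr; exact: critical_density_ge0.
rewrite /df divr_gt0 ?exprn_gt0// subr_gt0 -{1}critical_densityX.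
rewrite ltr_pM2l//.
apply: gt0_ltr_powR; rewrite // nnegrE; [exact: critical_density_ge0|exact: ltW].
Qed.

Lemma energy_profile_deriv_lt0 r : 0 < r -> r < rs -> df r < 0.
Proof.
move=> r0 rrs.
rewrite /df pmulr_llt0 ?invr_gt0 ?exprn_gt0// subr_lt0 -[ltRHS]critical_densityX.
rewrite ltr_pM2l//.
by apply: gt0_ltr_powR; rewrite // nnegrE ltW// (lt_trans r0).
Qed.

Lemma continuous_within_profile (g : R -> R) (a b : R) : 0 < a ->
  (forall r, 0 < r -> {for r, continuous g}) -> {within `[a, b], continuous g}.
Proof.
move=> a0 cg; apply: continuous_in_subspaceT => x.
by rewrite inE/= in_itv/= => /andP[ax _]; apply: cg; exact: lt_le_trans ax.
Qed.

(** The critical density may be an end point, because the mean value theorem uses the derivative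
    only strictly inside. Positivity of [a] is asked separately since [critical_density] is 0 at
    rest. *)
Lemma energy_profile_gt a b : rs <= a -> 0 < a -> a < b -> f a < f b.
Proof.
move=> rsa a0 ab.
have D x : x \in `]a, b[%R -> is_derive x 1 f (df x).
  rewrite in_itv/= => /andP[ax _].
  by apply: is_derive_energy_profile; exact: lt_trans ax.
have [c] := MVT ab D (continuous_within_profile a0 continuous_energy_profile).
rewrite in_itv/= => /andP[ac cb] E; rewrite -subr_gt0 E mulr_gt0 ?subr_gt0//.
by apply: energy_profile_deriv_gt0; exact: le_lt_trans ac.
Qed.

Lemma energy_profile_lt a b : 0 < a -> a < b -> b <= rs -> f b < f a.
Proof.
move=> a0 ab brs.
have D x : x \in `]a, b[%R -> is_derive x 1 f (df x).
  rewrite in_itv/= => /andP[ax _].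
  by apply: is_derive_energy_profile; exact: lt_trans ax.
have [c] := MVT ab D (continuous_within_profile a0 continuous_energy_profile).
rewrite in_itv/= => /andP[ac cb] E; rewrite -subr_lt0 E nmulr_rlt0 ?subr_gt0//.
apply: energy_profile_deriv_lt0; first exact: lt_trans ac.
exact: lt_le_trans brs.
Qed.

(** By Cauchy's mean value theorem the ratio of the increments is the ratio of the derivatives at
    some [c], which is [c] itself. The condition on [rs] keeps the zero of [df] out of the open
    interval. *)
Lemma momentum_energy_profile_lt a b : 0 < a -> a < b ->
  rs <= a \/ b <= rs ->
  exists2 c, a <= c <= b & G b - G a = c * (f b - f a).
Proof.
move=> a0 ab side.
have pos x : x \in `]a, b[%R -> 0 < x.
  by rewrite in_itv/= => /andP[ax _]; exact: lt_trans ax.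
have dfN0 x : x \in `]a, b[%R -> df x != 0.
  move=> xab; have x0 := pos _ xab; move: xab; rewrite in_itv/= => /andP[ax xb].
  case: side => [rsa|brs].
    by rewrite gt_eqF// energy_profile_deriv_gt0// (le_lt_trans rsa).
  by rewrite lt_eqF// energy_profile_deriv_lt0// (lt_le_trans xb).
have cf := continuous_within_profile (b := b) a0 continuous_energy_profile.
have cG := continuous_within_profile (b := b) a0 continuous_momentum_profile.
have Df x (xab : x \in `]a, b[%R) := is_derive_energy_profile (pos x xab).
have DG x (xab : x \in `]a, b[%R) := is_derive_momentum_profile (pos x xab).
have [c cab E] := cauchy_MVT ab cG cf DG Df dfN0.
have fN0 := differentiable_subr_neq0 ab cf Df dfN0.
rewrite mulfK ?dfN0// in E; exists c; last by rewrite E divfK.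
by move: cab; rewrite in_itv/= => /andP[/ltW -> /ltW ->].
Qed.

Lemma momentum_energy_profile a b : 0 < a -> 0 < b ->
  (rs <= a /\ rs <= b) \/ (a <= rs /\ b <= rs) ->
  exists2 c, Num.min a b <= c <= Num.max a b & G b - G a = c * (f b - f a).
Proof.
move=> a0 b0 side; have [ab|ba|<-] := ltgtP a b.
- apply: momentum_energy_profile_lt => //.
  by case: side => -[? ?]; [left|right].
- have [|c ? E] := momentum_energy_profile_lt b0 ba.
    by case: side => -[? ?]; [left|right].
  by exists c => //; rewrite -opprB E -mulrN opprB.
- by exists a; rewrite ?lexx// !subrr mulr0.
Qed.
End EnergyProfile.

(** * Flow regimes, and differentiation along the energy relation *)

Section ProfileRegime.
Context {R : realType}.
Variables gamma K s : R.
Hypotheses (gamma_gt1 : 1 < gamma) (K_gt0 : 0 < K) (s_ge0 : 0 <= s).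

Local Notation f := (energy_profile gamma K s).
Local Notation G := (momentum_profile gamma K s).
Local Notation rs := (critical_density gamma K s).

(* [Defs.Sub] is qualified since [Sub] is also the constructor of MathComp's
   subtypes. *)
Definition in_regime (rg : regime) (r : R) : Prop :=
  match rg with
  | Defs.Sub => rs < r
  | Crit => r = rs
  | Super => r < rs
  end.

(** Only [a] has a known regime: a density of equal energy strictly beyond [a] on its side would
    contradict strict monotonicity there, and at the critical density the energy has its strict
    minimum. The ordering is the one by which [height] selects its root. *)
Lemma energy_profile_extremal rg a b : in_regime rg a -> 0 < a -> 0 < b ->
  f b = f a ->
  match rg return Prop with
  | Defs.Sub => b <= a
  | Crit => b = a
  | Super => a <= b
  end.
Proof.
move=> + a0 b0 fab; case: rg => /= rga.
- rewrite leNgt; apply/negP => ab.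
  have := energy_profile_gt gamma_gt1 K_gt0 s_ge0 (ltW rga) a0 ab.
  by rewrite fab ltxx.
- have [ab|ba|//] := ltgtP b a; move: fab => /eqP.
  + rewrite gt_eqF//; apply: energy_profile_lt => //; by rewrite rga.
  + rewrite gt_eqF//; apply: energy_profile_gt => //; by rewrite rga.
- rewrite leNgt; apply/negP => ba.
  have := energy_profile_lt gamma_gt1 K_gt0 s_ge0 b0 ba (ltW rga).
  by rewrite fab ltxx.
Qed.

(** Here both densities have the regime, which is how [density] selects its root. *)
Lemma energy_profile_inj rg a b : in_regime rg a -> in_regime rg b ->
  0 < a -> 0 < b -> f b = f a -> b = a.
Proof.
move=> ra rb a0 b0 fab; have := energy_profile_extremal ra a0 b0 fab.
have := energy_profile_extremal rb b0 a0 (esym fab).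
by case: (rg) => //= ? ?; apply/eqP; rewrite eq_le; apply/andP.
Qed.


(** The squared quotient is (rs / r)^(gamma + 1), so comparing it with 1 amounts to comparing [rs]
    with [r]. *)
Lemma classify_profile r : 0 < r ->
  in_regime (classify (Num.sqrt (s / r ^+ 2) /
    Num.sqrt (gamma * K * r `^ (gamma - 1)))) r.
Proof.
move=> r0; have g0 : 0 < gamma by apply: lt_trans gamma_gt1.
have g1 : 0 < gamma + 1 by rewrite addr_gt0.
have gK0 : 0 < gamma * K by rewrite mulr_gt0.
set y := gamma * K * _; set x := s / _.
have y0 : 0 < y by rewrite !mulr_gt0// powR_gt0.
have x0 : 0 <= x by rewrite divr_ge0// exprn_ge0// ltW.
have sy0 : 0 < Num.sqrt y by rewrite sqrtr_gt0.
have yE : y = gamma * K * r `^ (gamma + 1) / r ^+ 2.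
  rewrite /y powR_sub1// powR_add1//; field; by rewrite gt_eqF.
have rs0 : 0 <= rs by exact: powR_ge0.
have sE : s = gamma * K * rs `^ (gamma + 1) by rewrite critical_densityX.
have mono := gt0_ltr_powR g1.
have rV : 0 < (r ^+ 2)^-1 by rewrite invr_gt0 exprn_gt0.
have [rrs|rsr|rrs] := ltgtP r rs.
- have yx : y < x.
    rewrite yE /x [in ltRHS]sE ltr_pM2r// ltr_pM2l// mono ?nnegrE//; exact: ltW.
  have : 1 < Num.sqrt x / Num.sqrt y.
    by rewrite ltr_pdivlMr// mul1r ltr_sqrt// (lt_trans y0).
  by rewrite /classify; case: ltgtP.
- have xy : x < y.
    rewrite yE /x [in ltLHS]sE ltr_pM2r// ltr_pM2l// mono ?nnegrE//; exact: ltW.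
  have : Num.sqrt x / Num.sqrt y < 1.
    by rewrite ltr_pdivrMr// mul1r ltr_sqrt.
  by rewrite /classify => ->.
- have xy : x = y by rewrite yE /x [in LHS]sE rrs.
  by rewrite xy /classify mulfV ?ltxx ?eqxx// gt_eqF.
Qed.

(* [rho] is not assumed differentiable: it need not be at a sonic point. *)
Lemma is_derive_momentum_profile_comp (V : normedModType R) (rho w : V -> R)
    (x v : V) (C dw : R) :
  rho (x + t *: v) @[t --> (0 : R)] --> rho x ->
  (\forall t \near (0 : R), 0 < rho (x + t *: v) /\
     f (rho (x + t *: v)) = C - w (x + t *: v)) ->
  is_derive x v w dw -> is_derive x v (G \o rho) (- (rho x * dw)).
Proof.
move=> crho eqn dwx.
have dw_cvg : h^-1 *: (w (h *: v + x) - w x) @[h --> (0 : R)^'] --> dw.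
  by have [dx <-] := dwx; exact: dx.
have crho' : rho (h *: v + x) @[h --> (0 : R)^'] --> rho x.
  apply: cvg_within_filter; apply: cvg_trans crho.
  by apply: near_eq_cvg; near=> h; rewrite addrC.
have eqn' : \forall h \near (0 : R)^', 0 < rho (h *: v + x) /\
     f (rho (h *: v + x)) = C - w (h *: v + x).
  by apply: nbhs_dnbhs; near=> h; rewrite addrC; near: h.
have [rx0 frx] : 0 < rho x /\ f (rho x) = C - w x.
  by have := nbhs_singleton eqn; rewrite scale0r addr0.
(* A critical [rho x] counts for both sides, so any nearby density shares a side with it; otherwise
   continuity keeps the nearby densities on the side of [rho x]. *)
have side : \forall h \near (0 : R)^',
    (rs <= rho x /\ rs <= rho (h *: v + x)) \/
    (rho x <= rs /\ rho (h *: v + x) <= rs).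
  have [lt|gt|eq] := ltgtP (rho x) rs.
  - by near=> h; right; split => //; near: h; exact: cvgr_le crho' _ lt.
  - by near=> h; left; split => //; near: h; exact: cvgr_ge crho' _ gt.
  - by near=> h; have [?|/ltW ?] := leP rs (rho (h *: v + x)); [left|right].
have key : h^-1 *: ((G \o rho) (h *: v + x) - (G \o rho) x)
    @[h --> (0 : R)^'] --> - (rho x * dw).
  have dwx0 : (rho x * (h^-1 * (w (h *: v + x) - w x)))
      @[h --> (0 : R)^'] --> rho x * dw.
    by apply: cvgM => //; exact: cvg_cst.
  set D := fun h : R => h^-1 * (w (h *: v + x) - w x).
  set q := fun h : R => h^-1 *: ((G \o rho) (h *: v + x) - (G \o rho) x).
  (* The difference quotients of [w] converge, while the density increment tends to 0 by continuity
     alone. *)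
  have bound0 : `|rho (h *: v + x) - rho x| * `|D h| @[h --> (0 : R)^'] --> 0.
    rewrite -[X in _ --> X](mul0r `|dw|).
    apply: cvgM; last exact: (cvg_norm dw_cvg).
    by have /subr_cvg0/cvg_norm := crho'; rewrite normr0.
  (* For an intermediate density [c] the quotient [q h] is [- c * D h], so the error is
     [(rho x - c) * D h], and [c] is no farther from [rho x] than the nearby density is. *)
  have diff0 : q h + rho x * D h @[h --> (0 : R)^'] --> 0.
    apply/norm_cvg0P; apply: (squeeze_cvgr _ (cvg_cst 0) bound0).
    near=> h; rewrite normr_ge0 -normrM/=.
    have [rh0 frh] : 0 < rho (h *: v + x) /\
        f (rho (h *: v + x)) = C - w (h *: v + x) by near: h.
    have sd : (rs <= rho x /\ rs <= rho (h *: v + x)) \/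
      (rho x <= rs /\ rho (h *: v + x) <= rs) by near: h.
    have [c cb E] := momentum_energy_profile gamma_gt1 K_gt0 s_ge0 rx0 rh0 sd.
    rewrite /q /= E frh frx.
    have -> : h^-1 *: (c * (C - w (h *: v + x) - (C - w x))) + rho x * D h =
              (rho x - c) * D h by rewrite /D /GRing.scale/=; ring.
    rewrite !normrM ler_wpM2r// ler_norml.
    by move: cb; rewrite /Num.min /Num.max; case: ltP => ? /andP[? ?];
      case: (ger0P (_ - _)) => ?; apply/andP; split; lra.
  rewrite (_ : q = (fun h => (q h + rho x * D h) - rho x * D h)); last first.
    by apply/funext => h; rewrite addrK.
  by rewrite -[- _]add0r; apply: cvgB.
apply: DeriveDef.
- by apply/cvg_ex; exists (- (rho x * dw)).
- exact/cvg_lim.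
Unshelve. all: by end_near.
Qed.
End ProfileRegime.

(** * Inverting the equilibrium variables *)

Section StateComponents.
Context {R : realType} {d : nat}.
Implicit Types (a b : R) (m u : 'rV[R]_d) (U : state R d).

Lemma first_c_mkstate a m b : first_c (mkstate a m b) = a.
Proof. by rewrite /first_c /mkstate row_mxKl row_mxKl mxE eqxx. Qed.

Lemma mom_mkstate a m b : mom (mkstate a m b) = m.
Proof. by rewrite /mom /mkstate row_mxKl row_mxKr. Qed.

Lemma last_c_mkstate a m b : last_c (mkstate a m b) = b.
Proof. by rewrite /last_c /mkstate row_mxKr mxE eqxx. Qed.

Lemma mkstate_eta U : mkstate (first_c U) (mom U) (last_c U) = U.
Proof.
have scal (A : 'M[R]_1) : (A 0 0)%:M = A by rewrite -mx11_scalar.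
by rewrite /mkstate /first_c /mom /last_c !scal !hsubmxK.
Qed.

Definition mkstateK := (first_c_mkstate, mom_mkstate, last_c_mkstate).

Lemma sqnorm_ge0 u : 0 <= sqnorm u.
Proof. by apply: sumr_ge0 => i _; rewrite -expr2 sqr_ge0. Qed.

Lemma sqnorm0 : sqnorm (0 : 'rV[R]_d) = 0.
Proof. by rewrite /sqnorm /dotp big1// => i _; rewrite mxE mul0r. Qed.

Lemma sqnormZ a u : sqnorm (a *: u) = a ^+ 2 * sqnorm u.
Proof. by rewrite /sqnorm /dotp mulr_sumr; apply: eq_bigr => i _; rewrite !mxE; ring. Qed.

Lemma sqnorm_vel U : sqnorm (vel U) = sqnorm (mom U) / first_c U ^+ 2.
Proof. by rewrite sqnormZ exprVn mulrC. Qed.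

Lemma vel_eq0 U : first_c U != 0 -> (vel U == 0) = (mom U == 0).
Proof. by move=> U0; rewrite scaler_eq0 invr_eq0 (negbTE U0). Qed.

End StateComponents.

Section InverseMap.
Context {R : realType} {d : nat}.
Implicit Types (U : state R d) (w : R).

Lemma entropyKE (gamma : R) U : 0 < first_c U ->
  entropyK gamma U * first_c U `^ gamma = pressure gamma U.
Proof. by move=> r0; rewrite divfK// gt_eqF// powR_gt0. Qed.

Lemma entropyK_gt0 (gamma : R) U : 0 < first_c U -> 0 < pressure gamma U ->
  0 < entropyK gamma U.
Proof. by move=> r0 p0; rewrite divr_gt0// powR_gt0. Qed.

Lemma euler_energy (gamma : R) U w : 0 < first_c U ->
  last_c (euler_eqvars gamma U w) =
  energy_profile gamma (entropyK gamma U) (sqnorm (mom U)) (first_c U) + w.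
Proof.
move=> r0; rewrite mkstateK /energy_profile powR_sub1// -entropyKE//.
by rewrite !mulrA.
Qed.

Lemma euler_regime (gamma : R) U : 1 < gamma -> 0 < first_c U ->
  0 < pressure gamma U ->
  in_regime gamma (entropyK gamma U) (sqnorm (mom U))
    (classify (mach (Euler gamma) U)) (first_c U).
Proof.
move=> g1 r0 p0; rewrite /mach /= /euler_sound sqnorm_vel.
by apply: classify_profile => //; [exact: entropyK_gt0|exact: sqnorm_ge0].
Qed.

(** At rest the closed formula undoes the enthalpy term. Otherwise the density of [U] meets the
    selection criterion of [xget], and injectivity of the energy within a regime makes it the only
    one to do so. *)
Lemma euler_inverse_eqvars (gamma : R) U w : 1 < gamma -> 0 < first_c U ->
  0 < pressure gamma U ->
  euler_inverse gamma (classify (mach (Euler gamma) U))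
    (euler_eqvars gamma U w) w = U.
Proof.
move=> g1 r0 p0; set rg := classify _; set V := euler_eqvars _ _ _.
have K0 := entropyK_gt0 r0 p0; have rN0 : first_c U != 0 by rewrite gt_eqF.
have KN0 : entropyK gamma U != 0 by rewrite gt_eqF.
have g0 : 0 < gamma by apply: lt_trans g1.
have g10 : 0 < gamma - 1 by rewrite subr_gt0.
have KV : first_c V = entropyK gamma U by rewrite mkstateK.
have mV : mom V = mom U by rewrite mkstateK.
have eV : last_c V - w =
    energy_profile gamma (entropyK gamma U) (sqnorm (mom U)) (first_c U).
  by rewrite euler_energy// addrK.
have rho : density gamma rg V w = first_c U.
  rewrite /density mV KV eV; case: ifPn => [/eqP m0|m0].
    rewrite /energy_profile m0 sqnorm0 mul0r add0r.
    rewrite (_ : _ * (_ * _ * _) = first_c U `^ (gamma - 1)); last first.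
      by field; rewrite KN0 !gt_eqF.
    by rewrite -powRrM mulfV ?gt_eqF// powRr1 ?ltW.
  apply: xget_unique => [|r [r'0 eqr rr]].
    split=> //.
      by rewrite /density_eq -addrA -(opprB (last_c V)) eV mV KV subrr.
    have := euler_regime g1 r0 p0; rewrite /rho_star KV mV -/rg.
    by case: rg.
  have ra := euler_regime g1 r0 p0.
  apply: (energy_profile_inj g1 K0 (sqnorm_ge0 _) ra) => //.
    by move: rr; rewrite /rho_star KV mV -/rg; case: rg.
  move: eqr; rewrite /density_eq -addrA -(opprB (last_c V)) eV mV KV => /eqP.
  by rewrite subr_eq0 => /eqP.
rewrite /euler_inverse rho mV KV -[RHS]mkstate_eta; congr mkstate.
rewrite -mulrA entropyKE// /pressure sqnorm_vel; field.
by rewrite rN0 gt_eqF.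
Qed.

Lemma energy_profile2 (K s r : R) : 0 <= r ->
  energy_profile 2 K s r = s / (2 * r ^+ 2) + 2 * K * r.
Proof.
move=> r0; rewrite /energy_profile.
by rewrite (_ : 2 - 1 = 1 :> R) ?powRr1 ?divr1//; ring.
Qed.

Lemma momentum_profile2 (K s r : R) : 0 <= r ->
  momentum_profile 2 K s r = s / r + K * r ^+ 2.
Proof. by move=> r0; rewrite /momentum_profile powR_mulrn. Qed.

Lemma ripa_energy (g : R) U w : 0 < first_c U ->
  first_c (ripa_eqvars g U w) =
  energy_profile 2 (g * theta U / 2) (sqnorm (mom U)) (first_c U)
  + g * theta U * w.
Proof. by move=> r0; rewrite mkstateK energy_profile2 ?ltW//; field; rewrite gt_eqF. Qed.

Lemma ripa_regime (g : R) U : 0 < g -> 0 < first_c U -> 0 < theta U ->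
  in_regime 2 (g * theta U / 2) (sqnorm (mom U))
    (classify (mach (Ripa g) U)) (first_c U).
Proof.
move=> g0 h0 t0; rewrite /mach /= /ripa_sound sqnorm_vel.
rewrite (_ : g * first_c U * theta U = 2 * (g * theta U / 2) * first_c U `^ (2 - 1)).
  apply: classify_profile; rewrite ?ltr1n ?sqnorm_ge0//.
  by apply: divr_gt0 => //; exact: mulr_gt0.
by rewrite (_ : 2 - 1 = 1 :> R) ?powRr1 ?ltW//; field.
Qed.

(** The cubic is [h ^+ 2] times the energy equation, so the two have the same positive roots. *)
Lemma height_rootE (g : R) (V : state R d) w h : 0 < h ->
  height_root g V w h <->
  energy_profile 2 (g * last_c V / 2) (sqnorm (mom V)) h =
  first_c V - g * last_c V * w.
Proof.
move=> h0; rewrite energy_profile2 ?ltW//.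
have hN0 : h != 0 by rewrite gt_eqF.
have E : g * last_c V * h ^+ 3 - (first_c V - g * w * last_c V) * h ^+ 2
  + 2^-1 * sqnorm (mom V) =
  h ^+ 2 * (sqnorm (mom V) / (2 * h ^+ 2) + 2 * (g * last_c V / 2) * h
     - (first_c V - g * last_c V * w)).
  by field.
rewrite /height_root E; split=> [[_ /eqP]|->]; last by rewrite subrr mulr0.
by rewrite mulf_eq0 expf_eq0/= (negbTE hN0)/= subr_eq0 => /eqP.
Qed.

(** The height of [U] is extremal among all positive roots in the sense of its regime. Any root
    satisfying the criterion of [xget] is extremal as well, and two such roots bound each other. *)
Lemma ripa_inverse_eqvars (g : R) U w : 0 < g -> 0 < first_c U -> 0 < theta U ->
  ripa_inverse g (classify (mach (Ripa g) U)) (ripa_eqvars g U w) w = U.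
Proof.
move=> g0 h0 t0; set rg := classify _; set V := ripa_eqvars _ _ _.
have hN0 : first_c U != 0 by rewrite gt_eqF.
have tV : last_c V = theta U by rewrite mkstateK.
have mV : mom V = mom U by rewrite mkstateK.
have K0 : 0 < g * theta U / 2 by apply: divr_gt0 => //; exact: mulr_gt0.
have ra := ripa_regime g0 h0 t0; rewrite -/rg in ra.
have lt12 : 1 < 2 :> R by rewrite ltr1n.
have rootP h : 0 < h -> height_root g V w h <->
    energy_profile 2 (g * theta U / 2) (sqnorm (mom U)) h =
    energy_profile 2 (g * theta U / 2) (sqnorm (mom U)) (first_c U).
  by move=> /height_rootE ->; rewrite tV mV ripa_energy// addrK.
have hE : height g rg V w = first_c U.
  rewrite /height mV tV; case: ifPn => [/eqP m0|m0].
    rewrite mkstateK m0 sqnorm0 mul0r add0r; field.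
    by rewrite !gt_eqF.
  have ext h : 0 < h -> height_root g V w h ->
      match rg return Prop with
      | Defs.Sub => h <= first_c U
      | Crit => h = first_c U
      | Super => first_c U <= h
      end.
    move=> h'0 /(rootP _ h'0) E.
    by have := energy_profile_extremal lt12 K0 (sqnorm_ge0 (mom U)) ra h0 h'0 E.
  have rU : height_root g V w (first_c U) by apply/rootP.
  apply: xget_unique => [|h [rh exth]].
    by split=> // h [h'0 eh]; apply: ext => //; split.
  have := ext _ rh.1 rh; have := exth _ rU.
  by case: (rg) => // ? ?; apply/eqP; rewrite eq_le; apply/andP.
rewrite /ripa_inverse hE mV tV -[RHS]mkstate_eta; congr mkstate.
by rewrite /theta mulrC divfK.
Qed.

Lemma inverse_eqvars (M : model R) U w : valid_model M -> physical M U ->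
  inverse M (classify (mach M U)) (eqvars M U w) w = U.
Proof.
by case: M => [gamma|g] /= vM [? ?];
  [exact: euler_inverse_eqvars|exact: ripa_inverse_eqvars].
Qed.

End InverseMap.

(** * Integration by parts on boxes *)

Section RectangleIntegral.
Context {R : realType}.
Let mu := @lebesgue_measure R.

Lemma Rintegral_FTC (F f : R -> R) (a b : R) : a < b ->
  {within `[a, b], continuous f} -> {within `[a, b], continuous F} ->
  (forall x, x \in `]a, b[%R -> is_derive x 1 F (f x)) ->
  \int[mu]_(x in `[a, b]) f x = F b - F a.
Proof.
move=> ab cf /(continuous_within_itvP _ ab)[_ Fa Fb] dF.
rewrite /Rintegral (continuous_FTC2 (F := F) ab cf)//.
  by split=> // x /dF [].
by move=> x xab; rewrite derive1E; have [] := dF _ xab.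
Qed.

Lemma integrable_segment (f : R -> R) (a b : R) :
  {within `[a, b], continuous f} -> mu.-integrable `[a, b] (EFin \o f).
Proof. by apply: continuous_compact_integrable; exact: segment_compact. Qed.

(** The product sigma-algebra is generated by measurable rectangles, so the open set is written as
    the countable union of the open rectangles with rational corners that it contains. *)
Lemma open_measurable_prod (A : set (R * R)) : open A ->
  measurable (A : set (measurableTypeR R * measurableTypeR R)).
Proof.
move=> oA.
pose B (p : (rat * rat) * (rat * rat)) : set (R * R) :=
  `]ratr p.1.1, ratr p.1.2[%classic `*` `]ratr p.2.1, ratr p.2.2[%classic.
pose F p := if `[< B p `<=` A >] then B p else set0.
have -> : A = \bigcup_p F p.
  apply/seteqP; split => [[x y] Axy|[x y] [p _]]; last first.
    by rewrite /F; case: asboolP => // BA /BA.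
  have /nbhs_ballP[e /= e0 eA] := open_nbhs_nbhs (conj oA Axy).
  have r0 (z : R) : z - e < z by rewrite ltrBlDr ltrDl.
  have r1 (z : R) : z < z + e by rewrite ltrDl.
  have [p1 /itvP hp1] := rat_in_itvoo (r0 x).
  have [q1 /itvP hq1] := rat_in_itvoo (r1 x).
  have [p2 /itvP hp2] := rat_in_itvoo (r0 y).
  have [q2 /itvP hq2] := rat_in_itvoo (r1 y).
  exists ((p1, q1), (p2, q2)) => //; rewrite /F; case: asboolP => [_|[]].
    by split; rewrite /= in_itv/= ?hp1 ?hq1 ?hp2 ?hq2.
  move=> [u v] [/=]; rewrite !in_itv/= => /andP[pu uq] /andP[pv vq].
  have ? : x - e < ratr p1 by rewrite hp1.
  have ? : ratr q1 < x + e by rewrite hq1.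
  have ? : y - e < ratr p2 by rewrite hp2.
  have ? : ratr q2 < y + e by rewrite hq2.
  by apply: eA; split => /=; rewrite /ball/= ltr_norml; apply/andP; split; lra.
apply: countable_bigcupT_measurable => [|p]; first exact: countableP.
rewrite /F; case: asboolP => // _; exact: measurableX.
Qed.

Variables (a b c e : R).
Let D : set (R * R) := `[a, b]%classic `*` `[c, e]%classic.

Lemma measurable_rectangle :
  measurable (D : set (measurableTypeR R * measurableTypeR R)).
Proof. exact: measurableX. Qed.

(** On a set of finite measure, boundedness and measurability suffice: the first comes from
    compactness, the second from preimages of open intervals being relatively open. *)
Lemma integrable_rectangle (f : R * R -> R) : {within D, continuous f} ->
  (mu \x mu)%E.-integrable D (EFin \o f).
Proof.
move=> cf.
have cD : compact D by apply: compact_setX; exact: segment_compact.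
apply: measurable_bounded_integrable.
- exact: measurable_rectangle.
- rewrite [ltLHS](product_measure1E mu mu)//.
  have fin (u v : R) : (mu `[u, v]%classic < +oo)%E.
    by rewrite /mu lebesgue_measure_itv/=; case: ifP => // _; rewrite -EFinB ltry.
  by rewrite lte_mul_pinfty// ge0_fin_numE.
- move/continuousP : cf => cf.
  apply: (measurability _ (measurable_realfun.RGenOpens.measurableE R)).
  move=> _ [_ [u [v ->] <-]].
  have /open_subspaceP[V oV VD] :
    open ((f : subspace D -> R) @^-1` `]u, v[%classic).
    by apply: cf; exact: interval_open.
  rewrite setIC -VD; apply: measurableI; first exact: open_measurable_prod.
  exact: measurable_rectangle.
- have /compact_bounded[M [_ mrt]] := continuous_compact cf cD.
  by exists M; split; rewrite ?num_real // => ? ? ? ?; exact: mrt.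
Qed.

Lemma continuous_slice2 (f : R * R -> R) x : {within D, continuous f} ->
  x \in `[a, b] -> {within `[c, e], continuous (fun y => f (x, y))}.
Proof.
move=> /subspace_continuousP cf xab; apply/subspace_continuousP => y yce.
apply: (@cvg_comp _ _ _ (fun y => (x, y)) f _ (within D (nbhs (x, y)))).
  move=> U /= DU; apply: (@filterS _ (nbhs y) _ (fun y' => D (x, y') -> U (x, y'))).
    by move=> y' /= DU' y'ce; apply: DU'; split.
  have : (x, y') @[y' --> y] --> (x, y).
    exact: (cvg_pair (G := nbhs x) (H := nbhs y) (cvg_cst x) cvg_id).
  by move=> /(_ _ DU).
by apply: cf; split.
Qed.

Lemma continuous_slice1 (f : R * R -> R) y : {within D, continuous f} ->
  y \in `[c, e] -> {within `[a, b], continuous (fun x => f (x, y))}.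
Proof.
move=> /subspace_continuousP cf yce; apply/subspace_continuousP => x xab.
apply: (@cvg_comp _ _ _ (fun x => (x, y)) f _ (within D (nbhs (x, y)))).
  move=> U /= DU; apply: (@filterS _ (nbhs x) _ (fun x' => D (x', y) -> U (x', y))).
    by move=> x' /= DU' x'ab; apply: DU'; split.
  have : (x', y) @[x' --> x] --> (x, y).
    exact: (cvg_pair (G := nbhs x) (H := nbhs y) cvg_id (cvg_cst y)).
  by move=> /(_ _ DU).
by apply: cf; split.
Qed.

Lemma mem_rectangle x y : ((x, y) \in D) = (x \in `[a, b]) && (y \in `[c, e]).
Proof. by apply/idP/andP => [|[]]; rewrite inE => // -[]. Qed.

Lemma Rintegral_rectangle12 (f : R * R -> R) : {within D, continuous f} ->
  Rintegral (mu \x mu)%E D f =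
  \int[mu]_(x in `[a, b]) \int[mu]_(y in `[c, e]) f (x, y).
Proof.
move=> cf; have fi := integrable_rectangle cf.
have mD := measurable_rectangle.
(* Fubini is applied on the whole plane, to [f] extended by zero. *)
rewrite [LHS]Rintegral_mkcond [RHS]Rintegral_mkcond.
have fi' : (mu \x mu)%E.-integrable setT (EFin \o (f \_ D)).
  by rewrite -restrict_EFin; apply/integrable_restrict => //; rewrite setTI.
rewrite {1}/Rintegral -(integral12_prod_meas1 fi'); congr fine.
apply: eq_integral => x _; rewrite /fubini_F/= [in RHS]patchE mem_setE.
case: ifPn => xab; last first.
  rewrite (eq_integral (fun=> 0%E)) ?integral0// => y _.
  by rewrite patchE mem_rectangle (negbTE xab).
(* The inner integral is finite, so its real-valued form loses nothing. *)
rewrite /Rintegral fineK; last first.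
  apply: integrable_fin_num => //.
  exact: integrable_segment (continuous_slice2 cf xab).
rewrite [RHS]integral_mkcond; apply: eq_integral => y _.
by rewrite !patchE mem_rectangle xab/= mem_setE; case: ifP.
Qed.

Lemma Rintegral_rectangle21 (f : R * R -> R) : {within D, continuous f} ->
  Rintegral (mu \x mu)%E D f =
  \int[mu]_(y in `[c, e]) \int[mu]_(x in `[a, b]) f (x, y).
Proof.
move=> cf; have fi := integrable_rectangle cf.
have mD := measurable_rectangle.
rewrite [LHS]Rintegral_mkcond [RHS]Rintegral_mkcond.
have fi' : (mu \x mu)%E.-integrable setT (EFin \o (f \_ D)).
  by rewrite -restrict_EFin; apply/integrable_restrict => //; rewrite setTI.
rewrite {1}/Rintegral -(integral21_prod_meas1 fi'); congr fine.
apply: eq_integral => y _; rewrite /fubini_G/= [in RHS]patchE mem_setE.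
case: ifPn => yce; last first.
  rewrite (eq_integral (fun=> 0%E)) ?integral0// => x _.
  by rewrite patchE mem_rectangle (negbTE yce) andbF.
rewrite /Rintegral fineK; last first.
  apply: integrable_fin_num => //.
  exact: integrable_segment (continuous_slice1 cf yce).
rewrite [RHS]integral_mkcond; apply: eq_integral => x _.
by rewrite !patchE mem_rectangle yce/= mem_setE andbT; case: ifP.
Qed.

End RectangleIntegral.


(** * Continuity on a subset, and derivatives along a line *)

Section WithinContinuity.
Context {R : realType}.

Lemma within_continuous_precomp (T U V : topologicalType) (A : set T)
    (B : set U) (g : T -> U) (f : U -> V) :
  {within A, continuous g} -> (forall x, A x -> B (g x)) ->
  {within B, continuous f} -> {within A, continuous (fun x => f (g x))}.
Proof.
move=> /subspace_continuousP cg AB /subspace_continuousP cf.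
apply/subspace_continuousP => x Ax.
apply: (@cvg_comp _ _ _ g f _ (within B (nbhs (g x)))).
  move=> W BW.
  have gW : nbhs x (fun y => A y -> B (g y) -> W (g y)) := cg _ Ax _ BW.
  apply: (@filterS _ (nbhs x) _ _ (fun y => A y -> W (g y)) _ gW) => y gWy Ay.
  by apply: gWy => //; exact: AB.
by apply: cf; exact: AB.
Qed.

Lemma cvg_rV (n : nat) (T : Type) (F : set_system T) (g : T -> 'rV[R]_n)
    (l : 'rV[R]_n) : Filter F ->
  (forall i, g x 0 i @[x --> F] --> l 0 i) -> g x @[x --> F] --> l.
Proof.
move=> FF gl U [P Pl PU]; apply: (@filterS _ F _ (fun x => forall i, P 0 i (g x 0 i))).
  by move=> x Px; apply: PU => i j; rewrite (ord1 i).
by apply: filter_forall => i; exact: gl (Pl 0 i).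
Qed.

Lemma within_continuous_coord (n : nat) (T : topologicalType) (A : set T)
    (g : T -> 'rV[R]_n) i :
  {within A, continuous g} -> {within A, continuous (fun x => g x 0 i)}.
Proof.
move=> /subspace_continuousP cg; apply/subspace_continuousP => x Ax.
apply: (cvg_comp g (fun M : 'rV[R]_n => M 0 i) (cg _ Ax)).
exact: coord_continuous.
Qed.

Section Arithmetic.
Context {T : topologicalType} (A : set T).
Implicit Types f g : T -> R.

Lemma within_continuousD f g : {within A, continuous f} ->
  {within A, continuous g} -> {within A, continuous (fun x => f x + g x)}.
Proof. by move=> cf cg x; apply: cvgD; [exact: cf|exact: cg]. Qed.

Lemma within_continuousM f g : {within A, continuous f} ->
  {within A, continuous g} -> {within A, continuous (fun x => f x * g x)}.
Proof. by move=> cf cg x; apply: cvgM; [exact: cf|exact: cg]. Qed.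

Lemma within_continuousN f : {within A, continuous f} ->
  {within A, continuous (fun x => - f x)}.
Proof. by move=> cf x; apply: cvgN; exact: cf. Qed.

Lemma within_continuous_cst (c : R) : {within A, continuous (fun=> c)}.
Proof. by move=> x; exact: cvg_cst. Qed.

Lemma within_continuous_sum (I : Type) (r : seq I) (F : I -> T -> R) :
  (forall i, {within A, continuous (F i)}) ->
  {within A, continuous (fun x => \sum_(i <- r) F i x)}.
Proof.
move=> cF; elim: r => [|i r IH].
  under eq_fun do rewrite big_nil; exact: within_continuous_cst.
by under eq_fun do rewrite big_cons; exact: within_continuousD.
Qed.

Lemma within_continuous_eq f g : (forall x, A x -> f x = g x) ->
  {within A, continuous f} -> {within A, continuous g}.
Proof.
by move=> fg; apply: subspace_eq_continuous => x /set_mem Ax; exact: fg.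
Qed.

End Arithmetic.

(** Turns a directional derivative in several variables into an ordinary one, as the fundamental
    theorem of calculus on a slice requires. *)
Lemma is_derive_line (V : normedModType R) (f : V -> R) (g : R -> R) (t : R)
    (x v : V) (df : R) :
  (forall h, g (h + t) = f (h *: v + x)) -> is_derive x v f df ->
  is_derive t 1 g df.
Proof.
move=> gf [dfx <-].
have gt : g t = f x by have := gf 0; rewrite scale0r !add0r.
have E : (fun h : R => h^-1 *: ((g \o shift t) (h *: 1) - g t)) =
         (fun h : R => h^-1 *: ((f \o shift x) (h *: v) - f x)).
  apply/funext => h /=; rewrite gt; congr (_ *: (_ - _)).
  by rewrite -gf /GRing.scale/= mulr1.
by apply: DeriveDef; [rewrite /derivable E|rewrite /derive E].
Qed.

End WithinContinuity.

(** * Boxes, and linearity of the integral over them *)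

Section BoxIntegral.
Context {R : realType} {d : nat}.
Implicit Types (a b x : 'rV[R]_d) (f g : 'rV[R]_d -> R).

(** [closed_cell S T] is this set with corners [lo S T] and [hi S T]. Without reference to a mesh it
    also serves for faces, which are boxes one dimension lower. *)
Definition box a b : set 'rV[R]_d :=
  [set x | forall i, a 0 i <= x 0 i <= b 0 i].

End BoxIntegral.

Section PlaneBox.
Context {R : realType}.
Let mu := @lebesgue_measure R.

(** The parametrisation by which [box_integral] is defined in dimension 2, with [rectangle] as its
    domain. *)
Definition pair_row (z : R * R) : 'rV[R]_2 := \row_j if j == 0 then z.1 else z.2.

Definition rectangle (a b : 'rV[R]_2) : set (R * R) :=
  `[a 0 0, b 0 0]%classic `*` `[a 0 1, b 0 1]%classic.

Lemma box_pair_row a b z : rectangle a b z -> box a b (pair_row z).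
Proof.
case: z => x y [/=]; rewrite !in_itv/= => hx hy [[|[|//]] i2]; rewrite mxE/=.
  by rewrite (_ : Ordinal i2 = 0)//; exact: val_inj.
by rewrite (_ : Ordinal i2 = 1)//; exact: val_inj.
Qed.

Lemma box_const_row (a b : 'rV[R]_1) s : s \in `[a 0 0, b 0 0] ->
  box a b (const_mx s).
Proof. by rewrite in_itv/= => sab i; rewrite ord1 mxE. Qed.

Lemma continuous_pair_row : continuous pair_row.
Proof.
move=> z; apply: cvg_rV => i; rewrite mxE.
under eq_fun do rewrite mxE.
by case: (i == 0); [exact: cvg_fst|exact: cvg_snd].
Qed.

Lemma continuous_const_row : continuous (const_mx : R -> 'rV[R]_1).
Proof.
move=> s; apply: cvg_rV => i; rewrite mxE.
under eq_fun do rewrite mxE.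
exact: cvg_id.
Qed.

Lemma within_continuous_pair_row a b (f : 'rV[R]_2 -> R) :
  {within box a b, continuous f} ->
  {within rectangle a b, continuous (fun z => f (pair_row z))}.
Proof.
apply: within_continuous_precomp; last exact: box_pair_row.
exact/continuous_subspaceT/continuous_pair_row.
Qed.

Lemma within_continuous_const_row (a b : 'rV[R]_1) (f : 'rV[R]_1 -> R) :
  {within box a b, continuous f} ->
  {within `[a 0 0, b 0 0], continuous (fun s => f (const_mx s))}.
Proof.
apply: within_continuous_precomp; last exact: box_const_row.
exact/continuous_subspaceT/continuous_const_row.
Qed.

End PlaneBox.

Section BoxIntegralTheory.
Context {R : realType}.
Implicit Type d : nat.

Lemma eq_box_integral d (a b : 'rV[R]_d) (f g : 'rV[R]_d -> R) :
  (forall x, box a b x -> f x = g x) -> box_integral a b f = box_integral a b g.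
Proof.
case: d => [|[|[|//]]] in a b f g * => fg /=.
- by apply: fg => -[].
- by apply: eq_Rintegral => s; rewrite mem_setE => sab; apply/fg/box_const_row.
- by apply: eq_Rintegral => z /set_mem Dz; apply: fg; exact: box_pair_row.
Qed.

Lemma box_integralD d (a b : 'rV[R]_d) (f g : 'rV[R]_d -> R) :
  {within box a b, continuous f} -> {within box a b, continuous g} ->
  box_integral a b (fun x => f x + g x) = box_integral a b f + box_integral a b g.
Proof.
case: d => [|[|[|d]]] in a b f g * => cf cg; rewrite /box_integral.
- by [].
- apply: RintegralD => //; apply: integrable_segment;
  exact: within_continuous_const_row.
- apply: RintegralD; first exact: measurable_rectangle.
    exact: integrable_rectangle (within_continuous_pair_row cf).
  exact: integrable_rectangle (within_continuous_pair_row cg).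
(* In dimensions above 2 [box_integral] is 0 by definition. *)
- by rewrite addr0.
Qed.

Lemma box_integral0 d (a b : 'rV[R]_d) : box_integral a b (fun=> 0) = 0.
Proof.
by case: d => [|[|[|d]]] in a b *; rewrite /box_integral//= /Rintegral integral0.
Qed.

Lemma box_integralN d (a b : 'rV[R]_d) (f : 'rV[R]_d -> R) :
  {within box a b, continuous f} ->
  box_integral a b (fun x => - f x) = - box_integral a b f.
Proof.
move=> cf; apply/eqP; rewrite -addr_eq0 -box_integralD//; last first.
  exact: within_continuousN.
by under eq_fun do rewrite addNr; rewrite box_integral0.
Qed.

Lemma box_integral_sum d (a b : 'rV[R]_d) (I : Type) (r : seq I)
    (F : I -> 'rV[R]_d -> R) :
  (forall i, {within box a b, continuous (F i)}) ->
  box_integral a b (fun x => \sum_(i <- r) F i x) =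
  \sum_(i <- r) box_integral a b (F i).
Proof.
move=> cF; elim: r => [|i r IH].
  by under eq_fun do rewrite big_nil; rewrite big_nil box_integral0.
under eq_fun do rewrite big_cons.
by rewrite big_cons box_integralD// ?IH//; exact: within_continuous_sum.
Qed.

End BoxIntegralTheory.

(** * The divergence theorem for a single partial derivative *)

Section BoxDivergence.
Context {R : realType}.
Let mu := @lebesgue_measure R.

Lemma insert_const (t : R) (y : 'rV[R]_0) : Defs.insert (0 : 'I_1) t y = const_mx t.
Proof. by apply/rowP => j; rewrite !mxE ord1; case: unliftP => // -[]. Qed.

Lemma insert_pair0 (t s : R) :
  Defs.insert (0 : 'I_2) t (const_mx s) = pair_row (t, s).
Proof.
by apply/rowP => j; rewrite !mxE; case: unliftP => [k ->|->]; rewrite ?mxE.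
Qed.

Lemma insert_pair1 (t s : R) :
  Defs.insert (1 : 'I_2) t (const_mx s) = pair_row (s, t).
Proof.
apply/rowP => j; rewrite !mxE; case: unliftP => [k ->|->]; rewrite ?mxE//.
by rewrite (ord1 k).
Qed.

Lemma box_integral_partial1 (a b : 'rV[R]_1) (f D : 'rV[R]_1 -> R) :
  a 0 0 < b 0 0 ->
  {within box a b, continuous f} -> {within box a b, continuous D} ->
  (forall x, box a b x -> a 0 0 < x 0 0 < b 0 0 ->
     is_derive x (delta_mx 0 0) f (D x)) ->
  box_integral a b D = f (const_mx (b 0 0)) - f (const_mx (a 0 0)).
Proof.
move=> ab cf cD dfD.
apply: (Rintegral_FTC (F := fun s => f (const_mx s))) => //;
  [exact: within_continuous_const_row|exact: within_continuous_const_row|].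
move=> s; rewrite in_itv/= => sab.
apply: (is_derive_line (x := const_mx s) (v := delta_mx 0 0)).
  by move=> h; congr f; apply/rowP => j; rewrite !mxE !ord1/= mulr1.
by apply: dfD; rewrite ?mxE// => j; rewrite mxE ord1; case/andP: sab => /ltW -> /ltW.
Qed.

(** Fubini with axis [i] innermost, then the fundamental theorem of calculus on each slice. The
    derivative is asked only strictly between the two faces orthogonal to axis [i], since [f] will
    be controlled on the closed box only. *)
Lemma box_integral_partial2 (a b : 'rV[R]_2) (i : 'I_2) (f D : 'rV[R]_2 -> R) :
  a 0 i < b 0 i ->
  {within box a b, continuous f} -> {within box a b, continuous D} ->
  (forall x, box a b x -> a 0 i < x 0 i < b 0 i ->
     is_derive x (delta_mx 0 i) f (D x)) ->
  box_integral a b D =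
  box_integral (col' i a) (col' i b) (fun y => f (Defs.insert i (b 0 i) y)) -
  box_integral (col' i a) (col' i b) (fun y => f (Defs.insert i (a 0 i) y)).
Proof.
move=> ab cf cD dfD.
have cf2 := within_continuous_pair_row cf.
have cD2 := within_continuous_pair_row cD.
have boxP x y : x \in `[a 0 0, b 0 0] -> y \in `[a 0 1, b 0 1] ->
  box a b (pair_row (x, y)) by move=> ? ?; apply: box_pair_row; split.
have [i0|i1] : i = 0 \/ i = 1.
  by case: (i) => -[|[|//]] ?; [left|right]; exact: val_inj.
- subst i; rewrite /box_integral (Rintegral_rectangle21 cD2).
  have l01 : lift 0 (0 : 'I_1) = 1 :> 'I_2 by exact: val_inj.
  have fi t : t \in `[a 0 0, b 0 0] -> mu.-integrable
      `[col' 0 a 0 0, col' 0 b 0 0]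
      (EFin \o (fun s => f (Defs.insert (0 : 'I_2) t (const_mx s)))).
    move=> tab; rewrite !mxE l01; apply: integrable_segment.
    apply: (within_continuous_eq _ (continuous_slice2 cf2 tab)) => s _.
    by rewrite insert_pair0.
  rewrite -RintegralB//=; [|by apply: fi; rewrite in_itv/= lexx ltW..].
  rewrite !mxE l01; apply: eq_Rintegral => y; rewrite mem_setE => yab.
  rewrite !insert_pair0.
  apply: (Rintegral_FTC (F := fun x => f (pair_row (x, y)))) => //.
  + exact: continuous_slice1 cD2 yab.
  + exact: continuous_slice1 cf2 yab.
  move=> x xab; apply: (is_derive_line (x := pair_row (x, y)) (v := delta_mx 0 0)).
    move=> h; congr f; apply/rowP => j; rewrite !mxE/=.
    by case: eqP => _; rewrite ?mulr1 ?mulr0 ?add0r.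
  apply: dfD; first by apply: boxP => //; exact: subset_itv_oo_cc.
  by rewrite mxE/=; move: xab; rewrite in_itv.
- subst i; rewrite /box_integral (Rintegral_rectangle12 cD2).
  have l10 : lift 1 (0 : 'I_1) = 0 :> 'I_2 by exact: val_inj.
  have fi t : t \in `[a 0 1, b 0 1] -> mu.-integrable
      `[col' 1 a 0 0, col' 1 b 0 0]
      (EFin \o (fun s => f (Defs.insert (1 : 'I_2) t (const_mx s)))).
    move=> tab; rewrite !mxE l10; apply: integrable_segment.
    apply: (within_continuous_eq _ (continuous_slice1 cf2 tab)) => s _.
    by rewrite insert_pair1.
  rewrite -RintegralB//=; [|by apply: fi; rewrite in_itv/= lexx ltW..].
  rewrite !mxE l10; apply: eq_Rintegral => x; rewrite mem_setE => xab.
  rewrite !insert_pair1.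
  apply: (Rintegral_FTC (F := fun y => f (pair_row (x, y)))) => //.
  + exact: continuous_slice2 cD2 xab.
  + exact: continuous_slice2 cf2 xab.
  move=> y yab; apply: (is_derive_line (x := pair_row (x, y)) (v := delta_mx 0 1)).
    move=> h; congr f; apply/rowP => -[[|[|//]] j2]; rewrite !mxE/=.
      by rewrite ?mulr1 ?mulr0 ?add0r.
    by rewrite ?mulr1 ?mulr0 ?add0r.
  apply: dfD; first by apply: boxP => //; exact: subset_itv_oo_cc.
  by rewrite mxE/=; move: yab; rewrite in_itv.
Qed.

Lemma box_integral_partial d (a b : 'rV[R]_d) (i : 'I_d) (f D : 'rV[R]_d -> R) :
  d = 1%N \/ d = 2%N -> a 0 i < b 0 i ->
  {within box a b, continuous f} -> {within box a b, continuous D} ->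
  (forall x, box a b x -> a 0 i < x 0 i < b 0 i ->
     is_derive x (delta_mx 0 i) f (D x)) ->
  box_integral a b D =
  box_integral (col' i a) (col' i b) (fun y => f (Defs.insert i (b 0 i) y)) -
  box_integral (col' i a) (col' i b) (fun y => f (Defs.insert i (a 0 i) y)).
Proof.
case=> d12; subst d; last exact: box_integral_partial2.
by rewrite ord1 => *; rewrite (box_integral_partial1 (f := f))//= !insert_const.
Qed.

End BoxDivergence.

(** * Regularity of polynomial test functions *)

Section PolynomialRegularity.
Context {R : realType} {d : nat}.
Implicit Types f g : 'rV[R]_d -> R.

(** Only partial derivatives of test functions enter the scheme, so directional derivatives suffice;
    sums and products inherit the property directly from the rules of differentiation. *)
Definition C1_directional f : Prop :=
  [/\ continuous f, forall x v, derivable f x v &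
      forall v, continuous (fun x => 'D_v f x)].

Lemma C1_directional_cst (c : R) : C1_directional (fun=> c).
Proof.
split=> [|x v|v]; first exact: (@cst_continuous 'rV[R]_d R c).
  exact: (derivable_cst (c : R) x v).
under eq_fun => x do rewrite (derive_cst (c : R) x v).
exact: (@cst_continuous 'rV[R]_d R 0).
Qed.

Lemma is_derive_coord (i : 'I_d) (x v : 'rV[R]_d) :
  is_derive x v (fun y : 'rV[R]_d => y 0 i) (v 0 i).
Proof.
have E : (fun h : R => h^-1 *: ((h *: v + x) 0 i - x 0 i)) @ 0^' --> v 0 i.
  have Ev : \forall h \near (0 : R)^', v 0 i = h^-1 *: ((h *: v + x) 0 i - x 0 i).
    near=> h; rewrite !mxE addrK /GRing.scale/= mulKf//.
    by near: h; exact: nbhs_dnbhs_neq.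
  exact: cvg_trans (near_eq_cvg Ev) (cvg_cst _).
by apply: DeriveDef; [apply/cvg_ex; exists (v 0 i)|exact: cvg_lim].
Unshelve. all: by end_near. Qed.

Lemma C1_directional_coord (i : 'I_d) : C1_directional (fun x => x 0 i).
Proof.
split=> [|x v|v]; first exact: coord_continuous.
  by have [] := is_derive_coord i x v.
under eq_fun => y do rewrite (@derive_val _ _ _ _ _ _ _ (is_derive_coord i y v)).
exact: (@cst_continuous 'rV[R]_d R (v 0 i)).
Qed.

Lemma C1_directionalD f g : C1_directional f -> C1_directional g ->
  C1_directional (fun x => f x + g x).
Proof.
move=> [cf df cdf] [cg dg cdg]; split=> [x|x v|v].
- exact: (cvgD (cf x) (cg x)).
- exact: derivableD.
rewrite (_ : (fun x => 'D_v _ x) = (fun x => 'D_v f x + 'D_v g x)).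
  by move=> x; exact: (cvgD (cdf v x) (cdg v x)).
by apply/funext => x; rewrite deriveD.
Qed.

Lemma C1_directionalM f g : C1_directional f -> C1_directional g ->
  C1_directional (fun x => f x * g x).
Proof.
move=> [cf df cdf] [cg dg cdg]; split=> [x|x v|v].
- exact: (cvgM (cf x) (cg x)).
- exact: derivableM.
rewrite (_ : (fun x => 'D_v _ x) = (fun x => f x * 'D_v g x + g x * 'D_v f x)).
  move=> x.
  have h1 : f y * 'D_v g y @[y --> x] --> f x * 'D_v g x.
    exact: (cvgM (cf x) (cdg v x)).
  have h2 : g y * 'D_v f y @[y --> x] --> g x * 'D_v f x.
    exact: (cvgM (cg x) (cdf v x)).
  exact: (cvgD h1 h2).
by apply/funext => x; rewrite deriveM.
Qed.

Lemma C1_directional_sum (I : Type) (r : seq I) (P : pred I)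
    (F : I -> 'rV[R]_d -> R) :
  (forall i, C1_directional (F i)) ->
  C1_directional (fun x => \sum_(i <- r | P i) F i x).
Proof.
move=> CF; elim: r => [|i r IH].
  under eq_fun do rewrite big_nil; exact: C1_directional_cst.
under eq_fun do rewrite big_cons; case: (P i) => //.
exact: C1_directionalD.
Qed.

Lemma C1_directional_prod (I : Type) (r : seq I) (F : I -> 'rV[R]_d -> R) :
  (forall i, C1_directional (F i)) ->
  C1_directional (fun x => \prod_(i <- r) F i x).
Proof.
move=> CF; elim: r => [|i r IH].
  under eq_fun do rewrite big_nil; exact: C1_directional_cst.
by under eq_fun do rewrite big_cons; exact: C1_directionalM.
Qed.

Lemma C1_directionalX f n : C1_directional f -> C1_directional (fun x => f x ^+ n).
Proof.
move=> Cf; elim: n => [|n IH].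
  under eq_fun do rewrite expr0; exact: C1_directional_cst.
by under eq_fun do rewrite exprS; exact: C1_directionalM.
Qed.

Lemma is_poly_C1 k f : is_poly k f -> C1_directional f.
Proof.
move=> [a fE]; rewrite (funext fE); apply: C1_directional_sum => e.
apply: C1_directionalM; first exact: C1_directional_cst.
apply: C1_directional_prod => i.
exact/C1_directionalX/C1_directional_coord.
Qed.

(** Places a constant [V] in the discrete space; the zero exponent carries the only coefficient. *)
Lemma is_poly_cst k (c : R) : is_poly (d := d) k (fun=> c).
Proof.
exists (fun e => if e == [ffun=> ord0] then c else 0) => x.
rewrite (bigD1 [ffun=> ord0])/=; last first.
  by rewrite big1// => i _; rewrite ffunE.
rewrite eqxx big1 ?mulr1 => [|i _]; last by rewrite ffunE expr0.
by rewrite big1 ?addr0// => e /andP[_ /negbTE ->]; rewrite mul0r.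
Qed.

End PolynomialRegularity.

(** * Flux and source at an equilibrium *)

Section StateEntries.
Context {R : realType} {d : nat}.
Implicit Types (a b : R) (m : 'rV[R]_d) (U : state R d).

Definition ix_first : 'I_(1 + d + 1) := lshift 1 (lshift d ord0).
Definition ix_mom (j : 'I_d) : 'I_(1 + d + 1) := lshift 1 (rshift 1 j).
Definition ix_last : 'I_(1 + d + 1) := rshift (1 + d) ord0.

Variant ix_spec : 'I_(1 + d + 1) -> Type :=
| IxFirst : ix_spec ix_first
| IxMom j : ix_spec (ix_mom j)
| IxLast : ix_spec ix_last.

Lemma ixP k : ix_spec k.
Proof.
case: (split_ordP k) => k' ->; last by rewrite (ord1 k'); exact: IxLast.
by case: (split_ordP k') => k2 ->; [rewrite (ord1 k2)|]; constructor.
Qed.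

Lemma mkstate_first a m b : mkstate a m b 0 ix_first = a.
Proof. by rewrite /mkstate !row_mxEl mxE eqxx. Qed.

Lemma mkstate_mom a m b j : mkstate a m b 0 (ix_mom j) = m 0 j.
Proof. by rewrite /mkstate row_mxEl row_mxEr. Qed.

Lemma mkstate_last a m b : mkstate a m b 0 ix_last = b.
Proof. by rewrite /mkstate row_mxEr mxE eqxx. Qed.

Definition mkstateE := (mkstate_first, mkstate_mom, mkstate_last).

Lemma first_cE U : first_c U = U 0 ix_first.
Proof. by rewrite -{2}(mkstate_eta U) mkstate_first. Qed.

Lemma row_mkflux (a : 'rV[R]_d) (m : 'M[R]_d) (b : 'rV[R]_d) i :
  row i (mkflux a m b) = mkstate (a 0 i) (row i m) (b 0 i).
Proof.
apply/rowP => k; case: (ixP k) => [|j|]; rewrite mkstateE mxE.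
- by rewrite /mkflux !row_mxEl mxE.
- by rewrite /mkflux row_mxEl row_mxEr mxE.
- by rewrite /mkflux row_mxEr mxE.
Qed.

End StateEntries.

Section EquilibriumProfile.
Context {R : realType} {d : nat}.
Variables (M : model R) (c : state R d).

(* The hypothesis on the momentum holds in dimension 1, and for fluid at rest. *)
Lemma equilibrium_profile : valid_model M ->
  (forall i j, mom c 0 i * mom c 0 j = sqnorm (mom c) *+ (i == j)) ->
  exists gamma K kappa e0 alpha beta : R, 1 < gamma /\
  forall U w, physical M U -> eqvars M U w = c ->
  [/\ 0 < K, 0 < first_c U,
      energy_profile gamma K (sqnorm (mom c)) (first_c U) = e0 - kappa * w,
      forall i, row i (flux M U) =
        mkstate (mom c 0 i)
          (momentum_profile gamma K (sqnorm (mom c)) (first_c U) *: delta_mx 0 i)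
          (mom c 0 i * (alpha - beta * w)) &
      forall dw, source M U dw =
        mkstate 0 (- (kappa * first_c U) *: dw) (- (beta * dotp (mom c) dw))].
Proof.
have [m mE] : exists m, m = mom c by exists (mom c).
rewrite -mE; case: M => [gamma|g] /= vM mc.
(* For Euler the energy flux (E + p) u is the momentum times epsilon - phi, hence [alpha] is epsilon
   and [beta] is 1. *)
- exists gamma, (first_c c), 1, (last_c c), (last_c c), 1; split=> // U w [r0 p0] cE.
  have mU : mom U = m by rewrite mE -cE mkstateK.
  have KU : first_c c = entropyK gamma U by rewrite -cE mkstateK.
  have eU : last_c c = energy_profile gamma (entropyK gamma U) (sqnorm m)
      (first_c U) + w by rewrite -cE euler_energy// mU.
  have rN0 : first_c U != 0 by rewrite gt_eqF.
  have gN0 : gamma - 1 != 0 by rewrite subr_eq0 gt_eqF.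
  have pE := entropyKE gamma r0.
  rewrite KU eU; split=> //.
  + exact: entropyK_gt0.
  + by rewrite mul1r addrK.
  + move=> i; rewrite row_mkflux; congr mkstate; first by rewrite mU.
    * apply/rowP => j; rewrite /vel mU !mxE big_ord1 !mxE.
      have -> : first_c U * ((first_c U)^-1 * m 0 i * ((first_c U)^-1 * m 0 j)) =
         (m 0 i * m 0 j) / first_c U by field.
      (* By [mc] the tensor rho u u^T is a multiple of the identity, so the momentum flux is the
         scalar profile times the identity. *)
      rewrite mc /momentum_profile pE [j == i]eq_sym.
      by case: (i == j); rewrite ?mulr1n ?mulr0n; field.
    * have -> : last_c U = pressure gamma U / (gamma - 1)
          + sqnorm m / (2 * first_c U).
        by rewrite /pressure sqnorm_vel mU; field; rewrite rN0.
      have -> : energy_profile gamma (entropyK gamma U) (sqnorm m) (first_c U)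
          = sqnorm m / (2 * first_c U ^+ 2)
            + gamma / (gamma - 1) * (pressure gamma U / first_c U).
        by rewrite /energy_profile powR_sub1// -pE !mulrA.
      by rewrite /vel mU !mxE; field; rewrite rN0 gN0.
  + move=> dw; rewrite /euler_source mul1r; congr mkstate.
    rewrite mul1r /dotp mulr_sumr; congr (- _).
    by apply: eq_bigr => j _; rewrite /vel mU mxE; field.
(* For Ripa the topography enters the energy with the factor g theta, which is [kappa]. The last
   flux is the discharge times the constant theta and has no source, hence [beta] is 0. *)
- exists 2, (g * last_c c / 2), (g * last_c c), (first_c c), (last_c c), 0.
  split=> [|U w [h0 t0] cE]; first by rewrite ltr1n.
  have mU : mom U = m by rewrite mE -cE mkstateK.
  have tU : last_c c = theta U by rewrite -cE mkstateK.
  have eU : first_c c = energy_profile 2 (g * theta U / 2) (sqnorm m)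
      (first_c U) + g * theta U * w by rewrite -cE ripa_energy// mU.
  have hN0 : first_c U != 0 by rewrite gt_eqF.
  rewrite tU eU; split=> //.
  + by apply: divr_gt0 => //; exact: mulr_gt0.
  + by rewrite addrK.
  + move=> i; rewrite row_mkflux; congr mkstate; first by rewrite mU.
    * apply/rowP => j; rewrite /vel mU !mxE big_ord1 !mxE.
      have -> : first_c U * ((first_c U)^-1 * m 0 i * ((first_c U)^-1 * m 0 j)) =
         (m 0 i * m 0 j) / first_c U by field.
      rewrite mc momentum_profile2 ?ltW// [j == i]eq_sym.
      by case: (i == j); rewrite ?mulr1n ?mulr0n; field.
    * by rewrite /vel mU !mxE /theta; field.
  + move=> dw; rewrite /ripa_source; congr mkstate; last by rewrite mul0r oppr0.
    by congr (- _ *: _); rewrite mulrAC.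
Qed.
End EquilibriumProfile.

Section EquilibriumFlux.
Context {R : realType} {d : nat}.

Lemma cvg_line (x : 'rV[R]_d) (v : 'rV[R]_d) :
  x + t *: v @[t --> (0 : R)] --> x.
Proof.
have : x + t *: v @[t --> (0 : R)] --> x + (0 : R) *: v.
  by apply: cvgD; [exact: cvg_cst|apply: cvgZ; [exact: cvg_id|exact: cvg_cst]].
by rewrite scale0r addr0.
Qed.

(** Only coordinate [i] moves, so [x] may lie on the faces parallel to axis [i]. *)
Lemma near_line_box (a b x : 'rV[R]_d) (i : 'I_d) :
  box a b x -> a 0 i < x 0 i < b 0 i ->
  \forall t \near (0 : R), box a b (x + t *: delta_mx 0 i).
Proof.
move=> xab /andP[ax xb].
have e0 : 0 < Num.min (x 0 i - a 0 i) (b 0 i - x 0 i).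
  by rewrite lt_min !subr_gt0 ax.
near=> t.
have : `|t| < Num.min (x 0 i - a 0 i) (b 0 i - x 0 i).
  by near: t; exact: (@nbhs0_lt _ R^o _ e0).
rewrite lt_min !ltr_norml => /andP[/andP[t1 t2] /andP[t3 t4]] j; rewrite !mxE/=.
have [->|ji] := eqVneq j i; last by rewrite mulr0 addr0 xab.
by rewrite mulr1; apply/andP; split; lra.
Unshelve. all: by end_near. Qed.

(** A directional derivative depends only on values along the line. This matters at boundary points
    of the cell, where the equilibrium relations hold along the line but not in a full
    neighbourhood. *)
Lemma is_derive_near_line (V : normedModType R) (f g : V -> R) (x v : V) (df : R) :
  (\forall t \near (0 : R), f (x + t *: v) = g (x + t *: v)) ->
  is_derive x v f df -> is_derive x v g df.
Proof.
move=> fg [dfx <-].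
have fgx : f x = g x by have := nbhs_singleton fg; rewrite scale0r addr0.
have E : \forall h \near (0 : R)^', h^-1 *: (f (h *: v + x) - f x) =
    h^-1 *: (g (h *: v + x) - g x).
  apply: nbhs_dnbhs; near=> h; rewrite fgx; congr (_ *: (_ - _)).
  by rewrite addrC; near: h.
have C : h^-1 *: (g (h *: v + x) - g x) @[h --> (0 : R)^'] --> 'D_v f x.
  by apply: cvg_trans (near_eq_cvg E) _; exact: dfx.
by apply: DeriveDef; [apply/cvg_ex; exists ('D_v f x)|exact: cvg_lim].
Unshelve. all: by end_near. Qed.

Variables (M : model R) (a b : 'rV[R]_d).
Variables (U : 'rV[R]_d -> state R d) (w : 'rV[R]_d -> R) (c : state R d).
Hypothesis vM : valid_model M.
Hypothesis mc : forall i j, mom c 0 i * mom c 0 j = sqnorm (mom c) *+ (i == j).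
Hypothesis cU : {within box a b, continuous U}.
Hypothesis Uc : forall x, box a b x ->
  physical M (U x) /\ eqvars M (U x) (w x) = c.
Hypothesis w1 : C1_on (box a b) w.

(** The steady balance law on the closed box. The partial derivatives of the flux are given as
    functions [D] continuous up to the boundary, where the flux itself need not be
    differentiable. *)
Lemma equilibrium_flux :
  exists D : 'I_d -> 'I_(1 + d + 1) -> 'rV[R]_d -> R,
  [/\ forall i k, {within box a b, continuous (fun x => flux M (U x) i k)},
      forall i k, {within box a b, continuous (D i k)},
      forall i k x, box a b x -> a 0 i < x 0 i < b 0 i ->
        is_derive x (delta_mx 0 i) (fun y => flux M (U y) i k) (D i k x) &
      forall k x, box a b x ->
        \sum_i D i k x = source M (U x) (\row_i pderiv w i x) 0 k].
Proof.
have [gamma [K [kappa [e0 [alpha [beta [g1 eqP]]]]]]] := equilibrium_profile vM mc.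
set s := sqnorm (mom c) in eqP.
have s0 : 0 <= s by exact: sqnorm_ge0.
pose rho x := first_c (U x).
pose Phi i x : state R d := mkstate (mom c 0 i)
  (momentum_profile gamma K s (rho x) *: delta_mx 0 i)
  (mom c 0 i * (alpha - beta * w x)).
have fluxE i k x : box a b x -> flux M (U x) i k = Phi i x 0 k.
  move=> /Uc[p /(eqP _ _ p)[_ _ _ E _]].
  by have /rowP/(_ k) := E i; rewrite mxE.
(* The derivative of [Phi i] along axis [i], with that of the momentum profile expressed through
   [w]: no derivative of the density occurs, which makes [D] continuous. *)
pose D (i : 'I_d) (k : 'I_(1 + d + 1)) (x : 'rV[R]_d) : R :=
  mkstate 0 (- (kappa * rho x * pderiv w i x) *: delta_mx 0 i)
    (- (beta * mom c 0 i * pderiv w i x)) 0 k.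
have crho : {within box a b, continuous rho}.
  rewrite (_ : rho = fun x => U x 0 (ix_first)); last first.
    by apply/funext => x; rewrite /rho first_cE.
  exact: within_continuous_coord.
have cw : {within box a b, continuous w}.
  apply: continuous_in_subspaceT => x; rewrite inE => /w1.1.
  exact: differentiable_continuous.
have rho0 x : box a b x -> 0 < K /\ 0 < rho x by move=> /Uc[p /(eqP _ _ p)[]].
exists D; split.
- move=> i k.
  apply: (within_continuous_eq (f := fun x => Phi i x 0 k)) => [x /fluxE -> //|].
  case: (ixP k) => [|j|].
  + under eq_fun do rewrite mkstateE; exact: within_continuous_cst.
  + under eq_fun do rewrite mkstateE mxE.
    apply: within_continuousM; last exact: within_continuous_cst.
    apply: (within_continuous_precomp (B := [set r : R | 0 < r])
      (f := momentum_profile gamma K s) crho).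
      by move=> x /rho0[].
    apply: continuous_in_subspaceT => r; rewrite inE => r0.
    exact: continuous_momentum_profile.
  + under eq_fun do rewrite mkstateE.
    apply: within_continuousM; first exact: within_continuous_cst.
    apply: within_continuousD; first exact: within_continuous_cst.
    apply: within_continuousN; apply: within_continuousM => //.
    exact: within_continuous_cst.
- move=> i k; case: (ixP k) => [|j|]; rewrite /D; under eq_fun do rewrite mkstateE.
  + exact: within_continuous_cst.
  + under eq_fun do rewrite mxE.
    apply: within_continuousM; last exact: within_continuous_cst.
    apply: within_continuousN; apply: within_continuousM; last exact: w1.2.
    by apply: within_continuousM => //; exact: within_continuous_cst.
  + apply: within_continuousN; apply: within_continuousM; last exact: w1.2.
    exact: within_continuous_cst.
- move=> i k x xab xi; have nb := near_line_box xab xi.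
  apply: (is_derive_near_line (f := fun y => Phi i y 0 k)).
    by near=> t; rewrite fluxE//; near: t.
  have dw : is_derive x (delta_mx 0 i) w (pderiv w i x).
    by apply: derivableP; apply: diff_derivable; exact: w1.1.
  have dPhi : is_derive x (delta_mx 0 i) (momentum_profile gamma K s \o rho)
      (- (rho x * (kappa * pderiv w i x))).
    have [K0 _] := rho0 _ xab.
    apply: (is_derive_momentum_profile_comp g1 K0 s0
      (w := fun y => kappa * w y) (C := e0)) => //.
    + move/subspace_continuousP : crho => /(_ _ xab) crho.
      apply: (@cvg_comp _ _ _ (fun t : R => x + t *: delta_mx 0 i) rho _
        (within (box a b) (nbhs x))) => // W BW.
      have lW : \forall t \near (0 : R), box a b (x + t *: delta_mx 0 i) ->
        W (x + t *: delta_mx 0 i) := @cvg_line x (delta_mx 0 i) _ BW.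
      apply: (@filterS2 _ (nbhs (0 : R)) _ _ _
        (fun t => W (x + t *: delta_mx 0 i)) _ nb lW) => t tb.
      exact.
    + near=> t; have tb : box a b (x + t *: delta_mx 0 i) by near: t.
      by have [p /(eqP _ _ p)[]] := Uc tb.
  case: (ixP k) => [|j|]; rewrite /D mkstateE.
  + under eq_fun do rewrite mkstateE; exact: is_derive_cst.
  + under eq_fun do rewrite mkstateE mxE.
    under eq_fun do rewrite mulrC.
    apply: (is_derive_eq (is_deriveZ _ _)).
    by rewrite /GRing.scale/= !mxE; ring.
  + under eq_fun do rewrite mkstateE.
    apply: is_derive_eq; rewrite /GRing.scale/=; ring.
- move=> k x xab; have [p /(eqP _ _ p)[_ _ _ _ ->]] := Uc xab.
  rewrite /D -/(rho x); case: (ixP k) => [|j|]; rewrite mkstateE.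
  + by rewrite big1// => i _; rewrite mkstateE.
  + rewrite (bigD1 j)//= mkstateE !mxE !eqxx/= mulr1 big1 => [|i ij].
      by rewrite addr0; ring.
    by rewrite mkstateE !mxE eqxx/= [j == i]eq_sym (negbTE ij) mulr0.
  + rewrite /dotp mulr_sumr -sumrN; apply: eq_bigr => i _.
    by rewrite mkstateE mxE mulrA.
Unshelve. all: by end_near. Qed.

End EquilibriumFlux.

(** * The scheme at an equilibrium *)

Section Insertion.
Context {R : realType} {d : nat}.
Implicit Types (a b x : 'rV[R]_d) (i : 'I_d) (t : R) (y : 'rV[R]_d.-1).

Lemma insert_at i t y : Defs.insert i t y 0 i = t.
Proof. by rewrite mxE unlift_none. Qed.

Lemma insert_lift i t y l : Defs.insert i t y 0 (lift i l) = y 0 l.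
Proof. by rewrite mxE liftK. Qed.

Lemma box_insert a b i t y : box (col' i a) (col' i b) y ->
  a 0 i <= t <= b 0 i -> box a b (Defs.insert i t y).
Proof.
move=> yab tab j; case: (unliftP i j) => [l ->|->]; last by rewrite insert_at.
by rewrite insert_lift; have := yab l; rewrite !mxE.
Qed.

Lemma continuous_insert i t : continuous (Defs.insert i t).
Proof.
move=> y; apply: (@cvg_rV R d _ (nbhs (y : 'rV[R]_d.-1))) => j.
case: (unliftP i j) => [l ->|->].
  under eq_fun do rewrite insert_lift.
  by rewrite insert_lift; exact: coord_continuous.
by under eq_fun do rewrite insert_at; rewrite insert_at; exact: cvg_cst.
Qed.

End Insertion.

Section MeshGeometry.
Context {R : realType} {d : nat}.
Variable S : scheme R d.
Hypothesis hmesh : valid_mesh S.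

Lemma lo_lt_hi T i : in_mesh S T -> lo S T 0 i < hi S T 0 i.
Proof.
move=> /(_ i)/andP[T0 Tn]; rewrite !mxE.
by have := @hmesh i (T i).-1; rewrite (prednK T0); exact.
Qed.

Lemma lo_closed_cell T : in_mesh S T -> closed_cell S T (lo S T).
Proof. by move=> mT i; rewrite lexx ltW// lo_lt_hi. Qed.

(** Cell index j spans nodes j - 1 to j, so the upper face of [T] is the lower face of the next
    cell, and conversely; the other coordinates have the same range in both cells. *)
Lemma face_neighbor T i s x : in_mesh S T -> in_mesh S (neighbor T i s) ->
  face S T i s x -> closed_cell S (neighbor T i s) x.
Proof.
move=> mT mT' [xT xi] j; have := xT j; rewrite !mxE !ffunE.
case: (eqVneq j i) => [->{j}|//] _.
have := mT' i; have := lo_lt_hi i mT'; rewrite !mxE !ffunE eqxx xi.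
case: s {xT mT' xi} => /=; rewrite /face_coord mxE.
  by move=> /ltW -> _; rewrite lexx.
by move=> /ltW -> _; rewrite lexx.
Qed.

Lemma face_insert T i s y : in_mesh S T ->
  box (col' i (lo S T)) (col' i (hi S T)) y ->
  face S T i s (Defs.insert i (face_coord S T i s) y).
Proof.
move=> mT yb; split; last exact: insert_at.
apply: box_insert => //; rewrite /face_coord.
by case: s; rewrite lexx ltW// lo_lt_hi.
Qed.

Lemma sqnorm_normal i s : sqnorm (normal i s : 'rV[R]_d) = 1.
Proof.
rewrite sqnormZ -exprM mulnC exprM sqrrN !expr1n mul1r /sqnorm /dotp.
rewrite (bigD1 i)//= mxE !eqxx mulr1 big1 ?addr0// => j ji.
by rewrite mxE eqxx (negbTE ji) mulr0.
Qed.

Lemma normal_mul i s (A : 'M[R]_(d, 1 + d + 1)) :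
  normal i s *m A = (-1) ^+ (~~ s) *: row i A.
Proof. by rewrite /normal -scalemxAl -rowE. Qed.

End MeshGeometry.

Section EquilibriumScheme.
Context {R : realType} {d : nat}.
Variables (S : scheme R d) (Ueq V : field R d).
Hypothesis hlaw : valid_model (law S).
Hypothesis hmesh : valid_mesh S.
Hypothesis homega : forall T, in_mesh S T -> C1_on (closed_cell S T) (omega S T).
Hypothesis hd : d = 1%N \/ d = 2%N.
Hypothesis heq : moving_equilibrium S Ueq.
Hypothesis hmom : forall T x, in_mesh S T -> closed_cell S T x -> forall i j,
  mom (Ueq T x) 0 i * mom (Ueq T x) 0 j = sqnorm (mom (Ueq T x)) *+ (i == j).
Hypothesis hflux : consistent (law S) (numflux S V).
Hypothesis hshock : shock_free S Ueq \/ resolves_shocks (law S) (numflux S V).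
Hypothesis hghost : compatible_boundary S Ueq.
Hypothesis hV : equals_eq S Ueq V.

Lemma inverse_eqV T x : physical_at S Ueq T x ->
  inverse (law S) (flow S T x) (eqV S Ueq T x) (omega S T x) = Ueq T x.
Proof. by move=> [p ->]; exact: inverse_eqvars. Qed.

Lemma mom_eqvars (M : model R) U (w : R) : mom (eqvars M U w) = mom U :> 'rV[R]_d.
Proof. by case: M => g /=; rewrite mkstateK. Qed.

Lemma Uint_equilibrium T x : in_mesh S T -> closed_cell S T x ->
  Uint S V T x = Ueq T x.
Proof.
move=> mT xT; rewrite /Uint hV// inverse_eqV//.
by have [_ [c /(_ _ xT)[]]] := heq mT.
Qed.

Lemma flux_star_equilibrium T i s x : in_mesh S T -> face S T i s x ->
  flux_star S V T i s x = normal i s *m flux (law S) (Ueq T x).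
Proof.
move=> mT xf; have xT : closed_cell S T x by case: xf.
have [_ [c /(_ _ xT)[pT _]] /(_ i s)[/(_ _ xf) pT' side]] := heq mT.
rewrite /flux_star Uint_equilibrium//.
set T' := neighbor T i s in pT' side *.
have VT : V T x = eqV S Ueq T x by exact: hV.
have VT' : Vext S V T i s x = eqV S Ueq T' x.
  rewrite /Vext -/T'; case: asboolP => mT'; last exact: hghost.
  by apply: hV => //; exact: face_neighbor xf.
have n1 := sqnorm_normal i s.
suff -> : numflux S V (Ustar_int S V T i s x) (Ustar_ext S V T i s x) (normal i s)
    = normal i s *m flux (law S) (Ustar_int S V T i s x) by rewrite subrr add0r.
(* Where [omega] is continuous each side keeps its own regime and its own [omega], so reconstruction
   changes nothing. *)
have eqw : omega S T x = omega S T' x ->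
    Ustar_int S V T i s x = Ueq T x /\ Ustar_ext S V T i s x = Ueq T' x.
  move=> ww; rewrite /Ustar_int /Ustar_ext /flow_star /omega_star -/T' VT VT'.
  by rewrite -ww maxxx lexx inverse_eqV// ww inverse_eqV.
case: side => [/(_ _ xf)[Jeq Ueq_eq]|sh]; last first.
  have [ww st] := sh _ xf; have [-> ->] := eqw ww.
  case: hshock => [nsh|res]; first by case: (nsh T i s mT).
  by apply: res => //; [case: pT|case: pT'].
have eqVV : eqV S Ueq T x = eqV S Ueq T' x by [].
suff [U pU [-> ->]] : exists2 U, physical (law S) U &
    Ustar_int S V T i s x = U /\ Ustar_ext S V T i s x = U.
  by exact: hflux.
rewrite /Ustar_int /Ustar_ext /flow_star /omega_star -/T' VT VT' -eqVV.
(* If [omega] jumps, both sides invert the common [V] with the [omega] and the regime of the cell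
   where the maximum is attained, and obtain the state of that cell. If it does not, the states
   agree by the definition of a smooth face. *)
have [lt|gt|ww] := ltgtP (omega S T x) (omega S T' x).
- exists (Ueq T' x); first by case: pT'.
  by rewrite eqVV inverse_eqV.
- exists (Ueq T x); first by case: pT.
  by rewrite inverse_eqV.
- exists (Ueq T x); first by case: pT.
  by split; [rewrite inverse_eqV|rewrite eqVV ww inverse_eqV// Ueq_eq].
Qed.

Lemma dg_rhs_equilibrium T phi : in_mesh S T -> vec_poly (degree S) phi ->
  dg_rhs S V T phi = 0.
Proof.
move=> mT Pphi; set a := lo S T; set b := hi S T.
have [cU [c Uc] _] := heq mT.
have lT := lo_closed_cell hmesh mT.
have mc i j : mom c 0 i * mom c 0 j = sqnorm (mom c) *+ (i == j).
  by have [_ <-] := Uc _ lT; rewrite mom_eqvars hmom.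
have Uc' x : box a b x -> physical (law S) (Ueq T x) /\
    eqvars (law S) (Ueq T x) (omega S T x) = c.
  by move=> /Uc[[p _] e].
have [D [cF cD dF divF]] := equilibrium_flux hlaw mc cU Uc' (homega mT).
(* [W i] is the flux along axis [i] paired with the test function, and [dW i] its partial derivative
   by the product rule. *)
pose W i x := \sum_k flux (law S) (Ueq T x) i k * phi x 0 k.
pose dW i x := \sum_k (flux (law S) (Ueq T x) i k * pderiv (fun y => phi y 0 k) i x
  + phi x 0 k * D i k x).
have C1phi k : C1_directional (fun x => phi x 0 k) := is_poly_C1 (Pphi k).
have cphi k : {within box a b, continuous (fun x => phi x 0 k)}.
  by apply: continuous_subspaceT; have [] := C1phi k.
have cdphi k i : {within box a b, continuous (pderiv (fun x => phi x 0 k) i)}.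
  by apply: continuous_subspaceT => x; have [_ _ ] := C1phi k; exact.
have cW i : {within box a b, continuous (W i)}.
  by apply: within_continuous_sum => k; exact: within_continuousM.
have cdW i : {within box a b, continuous (dW i)}.
  apply: within_continuous_sum => k; apply: within_continuousD;
  exact: within_continuousM.
have dWP i x : box a b x -> a 0 i < x 0 i < b 0 i ->
    is_derive x (delta_mx 0 i) (W i) (dW i x).
  move=> xab xi.
  have -> : W i = \sum_k ((fun y => flux (law S) (Ueq T y) i k) \*
      (fun y => phi y 0 k)).
    by apply/funext => y; rewrite fct_sumE.
  rewrite /dW; apply: is_derive_sum => k.
  have [_ dphi _] := C1phi k.
  apply: (is_derive_eq (is_deriveM (dF i k x xab xi) (derivableP (dphi x _)))).
  by rewrite /GRing.scale/= /pderiv.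
(* The modified flux being the interior one, only the sign of the outward normal remains. *)
have faceE i s : face_integral S T i s
    (fun x => dotp (flux_star S V T i s x) (phi x)) =
    (-1) ^+ (~~ s) * face_integral S T i s (W i).
  have cWi : {within box (col' i a) (col' i b), continuous
      (fun y => W i (Defs.insert i (face_coord S T i s) y))}.
    apply: (within_continuous_precomp (B := box a b)) => //.
      exact/continuous_subspaceT/continuous_insert.
    by move=> y /(face_insert hmesh s mT)[].
  rewrite /face_integral (eq_box_integral (g := fun y => (-1) ^+ (~~ s) *
      W i (Defs.insert i (face_coord S T i s) y))).
    case: s cWi => cWi /=; first by rewrite mul1r; under eq_fun do rewrite mul1r.
    rewrite mulN1r -box_integralN//.
    by under eq_fun do rewrite mulN1r.
  move=> y /(face_insert hmesh s mT) yf; rewrite flux_star_equilibrium// normal_mul.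
  rewrite /dotp /W mulr_sumr; apply: eq_bigr => k _.
  by rewrite !mxE mulrA.
have divW i : cell_integral S T (dW i) =
    face_integral S T i true (W i) - face_integral S T i false (W i).
  exact: (box_integral_partial hd (lo_lt_hi hmesh i mT) (cW i) (cdW i) (dWP i)).
(* The two volume integrals are brought together: their integrands are the two halves of the sum of
   the [dW i], whose integral equals the face terms by [divW]. *)
rewrite /dg_rhs addrAC.
have -> : \sum_i \sum_s face_integral S T i s
    (fun x => dotp (flux_star S V T i s x) (phi x)) =
    \sum_i cell_integral S T (dW i).
  apply: eq_bigr => i _; rewrite big_bool /= !faceE divW/=.
  by rewrite mul1r mulN1r.
rewrite /cell_integral -(box_integral_sum _ cdW).
rewrite (eq_box_integral (g := fun x => \sum_i \sum_k
  flux (law S) (Ueq T x) i k * pderiv (fun y => phi y 0 k) i x)); last first.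
  move=> x xab; rewrite Uint_equilibrium//; apply: eq_bigr => i _.
  by apply: eq_bigr => k _; rewrite mxE.
rewrite [X in _ + X - _](eq_box_integral (g := fun x => \sum_i \sum_k
  phi x 0 k * D i k x)); last first.
  move=> x xab; rewrite Uint_equilibrium// exchange_big/=; apply: eq_bigr => k _.
  by rewrite -divF// mulrC mulr_sumr.
rewrite -box_integralD; first last.
- by do 2 (apply: within_continuous_sum => ?); exact: within_continuousM.
- by do 2 (apply: within_continuous_sum => ?); exact: within_continuousM.
apply/eqP; rewrite subr_eq0; apply/eqP/eq_box_integral => x _.
by rewrite -big_split/=; apply: eq_bigr => i _; rewrite -big_split.
Qed.

End EquilibriumScheme.

(** * Hydrostatic states as moving equilibria *)

Section HydrostaticEquilibrium.
Context {R : realType} {d : nat}.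

Lemma physical_first_gt0 (M : model R) (U : state R d) :
  physical M U -> 0 < first_c U.
Proof. by case: M => g []. Qed.

(** Velocity is among the hydrostatic variables, so both states are at rest. The kinetic term then
    vanishes and the equilibrium variables are functions of the hydrostatic ones. *)
Lemma eqvars_hydrostatic (M : model R) (U U' : state R d) (w w' : R) :
  physical M U -> physical M U' -> vel U = 0 ->
  hydrostatic_vars M U w = hydrostatic_vars M U' w' ->
  eqvars M U w = eqvars M U' w'.
Proof.
move=> /physical_first_gt0 r0 /physical_first_gt0 r0' v0 hE.
have v0' : vel U' = 0.
  by move: hE; case: M => g /(congr1 mom); rewrite /= !mkstateK v0.
have m0 : mom U = 0 by apply/eqP; rewrite -vel_eq0 ?v0// gt_eqF.
have m0' : mom U' = 0 by apply/eqP; rewrite -vel_eq0 ?v0'// gt_eqF.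
move: hE; case: M => g /= hE;
  rewrite /euler_eqvars /ripa_eqvars m0 m0' sqnorm0 !mul0r.
  have := congr1 first_c hE; have := congr1 last_c hE; rewrite !mkstateK.
  by rewrite !add0r => -> ->.
have := congr1 first_c hE; have := congr1 last_c hE; rewrite !mkstateK.
by move=> -> ->.
Qed.

(** Lets one argument serve both kinds of equilibrium. The constant is read off at the corner
    [lo S T], a point of the cell. *)
Lemma hydrostatic_moving (S : scheme R d) (Ueq : field R d) : valid_mesh S ->
  hydrostatic_equilibrium S Ueq -> moving_equilibrium S Ueq.
Proof.
move=> hmesh [heq v0] T mT; have [cU [c Uc] faces] := heq _ mT.
have lT := lo_closed_cell hmesh mT; split=> //.
  exists (eqvars (law S) (Ueq T (lo S T)) (omega S T (lo S T))) => x xT.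
  have [[p e] E] := Uc _ xT; have [[pl _] El] := Uc _ lT; split=> //.
  by apply: eqvars_hydrostatic => //; [exact: v0|rewrite E El].
move=> i s; have [pT' side] := faces i s; split=> //.
case: side => [sm|]; [left|by right].
move=> x xf; have [E inj] := sm _ xf; split=> //.
have xT : closed_cell S T x by case: xf.
have [[p _] _] := Uc _ xT; have [p' _] := pT' _ xf.
by apply: eqvars_hydrostatic => //; exact: v0.
Qed.

End HydrostaticEquilibrium.

(** * Newton iteration and Runge-Kutta stages *)

Lemma newton_solution_start (R : realType) (d : nat) (S : scheme R d) T G
    (w0 w : 'rV[R]_d -> state R d) :
  solves S T G w0 -> newton_solution S T G w0 w -> w = w0.
Proof.
move=> sol [_ _ [it [it0 step lim_it]]].
(* From a solution only the trivial step is possible: the linearised step requires a residual that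
   does not vanish. *)
have itE m : it m = w0.
  by elim: m => [//|m IH]; case: (step m); rewrite IH => -[].
apply/funext => x; apply/rowP => c; have := lim_it x c.
under eq_fun do rewrite itE.
by move=> /(cvg_unique _)/(_ (cvg_cst _)) ->.
Qed.

Lemma newton_solution_refl (R : realType) (d : nat) (S : scheme R d) T G
    (w : 'rV[R]_d -> state R d) :
  vec_poly (degree S) w -> solves S T G w -> newton_solution S T G w w.
Proof.
move=> Pw sol; split=> //; exists (fun=> w); split=> // [m|x c]; first by left.
exact: cvg_cst.
Qed.

Section Stages.
Context {R : realType} {d : nat} (S : scheme R d) (T : cell d).
Implicit Types V W : field R d.

Lemma stage1_solves V :
  (forall phi, vec_poly (degree S) phi -> dg_rhs S V T phi = 0) ->
  solves S T (stage1 S V T) (V T).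
Proof. by move=> rhs0 phi Pphi; rewrite /stage1 rhs0// mulr0 addr0. Qed.

(** Once both masses agree on [T], the weights 3/4 and 1/4 add up to one; likewise 1/3 and 2/3 in
    the third stage. *)
Lemma stage2_solves V W : W T = V T ->
  (forall phi, vec_poly (degree S) phi -> dg_rhs S W T phi = 0) ->
  solves S T (stage2 S V W T) (W T).
Proof.
by move=> WV rhs0 phi Pphi; rewrite /stage2 rhs0// mulr0 addr0 -WV; field.
Qed.

Lemma stage3_solves V W : W T = V T ->
  (forall phi, vec_poly (degree S) phi -> dg_rhs S W T phi = 0) ->
  solves S T (stage3 S V W T) (W T).
Proof.
by move=> WV rhs0 phi Pphi; rewrite /stage3 rhs0// mulr0 addr0 -WV; field.
Qed.

End Stages.

Theorem theorem3p3 (R : realType) (d : nat) (S : scheme R d) (Ueq : field R d)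
  (hlaw : valid_model (law S))
  (hmesh : valid_mesh S)
  (hdt : 0 < dt S)
  (homega : forall T, in_mesh S T -> C1_on (closed_cell S T) (omega S T))
  (heq : (d = 1%N /\ moving_equilibrium S Ueq) \/
         (d = 2%N /\ hydrostatic_equilibrium S Ueq))
  (hflux : forall V, consistent (law S) (numflux S V))
  (hshock : shock_free S Ueq \/
            forall V, resolves_shocks (law S) (numflux S V))
  (hghost : compatible_boundary S Ueq) :
  (exists V V1 V2 : nat -> field R d,
     numerical_solution S V V1 V2 /\ equals_eq S Ueq (V 0%N)) /\
  (forall V V1 V2 : nat -> field R d,
     numerical_solution S V V1 V2 -> equals_eq S Ueq (V 0%N) ->
     forall n,
       [/\ equals_eq S Ueq (V n), equals_eq S Ueq (V1 n),
           equals_eq S Ueq (V2 n) &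
           forall T x, in_mesh S T -> closed_cell S T x ->
             Uint S (V n) T x = Ueq T x]).
Proof.
have d12 : d = 1%N \/ d = 2%N by case: heq => -[d12 _]; [left|right].
have heqV : moving_equilibrium S Ueq.
  by case: heq => -[_ //]; exact: hydrostatic_moving.
have hmom T x : in_mesh S T -> closed_cell S T x -> forall i j,
    mom (Ueq T x) 0 i * mom (Ueq T x) 0 j = sqnorm (mom (Ueq T x)) *+ (i == j).
  (* In dimension 1 there is a single entry; at rest both sides are 0. *)
  move=> mT xT i j; case: heq => [[d1 _]|[_ [_ /(_ _ mT _ xT) v0]]].
    by subst d; rewrite !ord1 /sqnorm /dotp big_ord1.
  have [_ [c /(_ _ xT)[[/physical_first_gt0 r0 _] _]] _] := heqV _ mT.
  have -> : mom (Ueq T x) = 0 by apply/eqP; rewrite -vel_eq0 ?v0// gt_eqF.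
  by rewrite sqnorm0 mxE mul0r mul0rn.
have hshockV V : shock_free S Ueq \/ resolves_shocks (law S) (numflux S V).
  by case: hshock; [left|right].
have rhs0 V T : equals_eq S Ueq V -> in_mesh S T -> forall phi,
    vec_poly (degree S) phi -> dg_rhs S V T phi = 0.
  by move=> VE mT phi; 
  exact: (dg_rhs_equilibrium hlaw hmesh homega d12 heqV hmom (hflux V)
    (hshockV V) hghost VE mT).
split.
  (* Freezing the value at a corner makes each branch a constant polynomial on the whole space,
     whereas [eqV] is known to be constant only on the closed cell. *)
  pose V : field R d := fun T _ => eqV S Ueq T (lo S T).
  have VE : equals_eq S Ueq V.
    move=> T mT x xT; have [_ [c Uc] _] := heqV _ mT.
    have [_ e] := Uc _ (lo_closed_cell hmesh mT); have [_ e'] := Uc _ xT.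
    by rewrite /V /eqV e e'.
  have PV T : vec_poly (degree S) (V T) by move=> k; exact: is_poly_cst.
  exists (fun=> V), (fun=> V), (fun=> V); split=> //; split=> [T _ //|n T mT].
  have rhsV := rhs0 _ _ VE mT.
  by split; apply: newton_solution_refl => //;
    [exact: stage1_solves|exact: stage2_solves|exact: stage3_solves].
move=> V V1 V2 [_ sol] V0E.
have step n : equals_eq S Ueq (V n) -> [/\ equals_eq S Ueq (V1 n),
    equals_eq S Ueq (V2 n) & equals_eq S Ueq (V n.+1)].
  move=> VE.
  (* The stages are compared as functions, not merely on the closed cell: this is the form of
     equality that [stage2_solves] and [stage3_solves] take. *)
  have V1V T : in_mesh S T -> V1 n T = V n T.
    move=> mT; have [N1 _ _] := sol n _ mT.
    exact: newton_solution_start (stage1_solves (rhs0 _ _ VE mT)) N1.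
  have V1E : equals_eq S Ueq (V1 n) by move=> T mT x xT; rewrite V1V// VE.
  have V2V T : in_mesh S T -> V2 n T = V n T.
    move=> mT; have [_ N2 _] := sol n _ mT; rewrite -(V1V T mT).
    exact: newton_solution_start (stage2_solves (V1V T mT) (rhs0 _ _ V1E mT)) N2.
  have V2E : equals_eq S Ueq (V2 n) by move=> T mT x xT; rewrite V2V// VE.
  split=> // T mT x xT; have [_ _ N3] := sol n _ mT; rewrite -(V2E _ mT _ xT).
  congr (_ x).
  exact: newton_solution_start (stage3_solves (V2V T mT) (rhs0 _ _ V2E mT)) N3.
have VE n : equals_eq S Ueq (V n) by elim: n => [//|n /step[]].
move=> n; have [V1E V2E _] := step n (VE n); split=> // T x mT xT.
exact: Uint_equilibrium.
Qed.
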